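(* Let $n$ be even and let $X$ be a random symmetric $n\times n$ matrix with $X_{ii}=0$ and, for $i<j$ independently, $X_{ij}=X_{ji}\in\{\pm1\}$ each with probability $1/2$. Let $X=\sum_{i=1}^n\lambda_iu_iu_i^T$ be its eigendecomposition with $\lambda_1\ge\dots\ge\lambda_n$, and $X^+=\sum_{i=1}^{n/2}\lambda_iu_iu_i^T$. Then for every $k\in[n]$ and every $t>0$, $$\frac1{\sqrt n}\mathbb{E}[X^+_{kk}]=\frac{4}{3\pi}+o(1)\quad\text{and}\quad \Pr\left[\left|\frac1{\sqrt n}X^+_{kk}-\frac1{\sqrt n}\mathbb{E}[X^+_{kk}]\right|\ge t\right]\le O\!\left(\frac{1}{t^2\sqrt n}\right).$$ *)

(* Defs.v *)
From HB Require Import structures.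
From mathcomp Require Import all_boot all_order all_algebra.
From mathcomp Require Import reals trigo.
Set Implicit Arguments. Unset Strict Implicit. Unset Printing Implicit Defensive.
Import Order.TTheory GRing.Theory Num.Theory.
Local Open Scope ring_scope.

Definition upair (n : nat) := {p : 'I_n * 'I_n | (p.1 < p.2)%N}.

(* sample space: one fair sign for each pair i<j; uniform measure *)
Definition Omega (n : nat) := {ffun upair n -> bool}.

Section Defs.
Variable R : realType.

Definition sgn_at n (s : Omega n) (p : 'I_n * 'I_n) : R :=
  odflt 0 (omap (fun q : upair n => if s q then 1 else -1) (insub p)).

Definition signmx n (s : Omega n) : 'M[R]_n :=
  \matrix_(i, j) (if (i < j)%N then sgn_at s (i, j)
                  else if (j < i)%N then sgn_at s (j, i) else 0).

Definition Expect n (f : Omega n -> R) : R :=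
  (\sum_(s : Omega n) f s) / #|{: Omega n}|%:R.
Definition Prob n (A : pred (Omega n)) : R :=
  #|[set s | A s]|%:R / #|{: Omega n}|%:R.

Definition is_eigdec n (X U : 'M[R]_n) (lam : 'rV[R]_n) : Prop :=
  [/\ U^T *m U = 1%:M,
      X = \sum_(i < n) lam 0 i *: (col i U *m (col i U)^T)
    & forall i j : 'I_n, (i <= j)%N -> lam 0 j <= lam 0 i].

Definition Xplus n (U : 'M[R]_n) (lam : 'rV[R]_n) : 'M[R]_n :=
  \sum_(i < n | (i < n./2)%N) lam 0 i *: (col i U *m (col i U)^T).

End Defs.

(* Main.v *)
Require Import Defs.
From HB Require Import structures.
From mathcomp Require Import all_boot all_order all_algebra.
From mathcomp Require Import reals trigo.
From mathcomp Require Import topology normedtype derive.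
From mathcomp Require Import ring lra zify.
Import Order.TTheory GRing.Theory Num.Theory.
Import numFieldNormedType.Exports.
Local Open Scope ring_scope.
Set Implicit Arguments. Unset Strict Implicit. Unset Printing Implicit Defensive.

(** Since X has zero diagonal, X^+_kk is |X|_kk / 2 up to a multiple of the median eigenvalues; more precisely the difference is at most c in absolute value as soon as lam_{n/2+1} <= c and lam_{n/2} >= - c, and its square is always at most n. Put q = n^(1/4); everything happens at spectral scales y >= h = 8 q.

Let (X - i y)^-1 = K + i Y. Flipping one sign is a perturbation of rank two, so the resolvent identity and the Efron-Stein inequality on the discrete cube bound Var (tr Y), Var (tr K) by 4 n^2 / y^4 and Var Y_kk by O(y^-4 + n y^-6). Integrating by parts over each sign in E (X K)_kk = 1 - y E Y_kk gives E [Y_kk tr Y] + y E Y_kk = 1 + o(1) (the term in K is small because E tr K = 0 by the symmetry X -> - X), hence E Y_kk is close to the semicircle value.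

Writing |x| = (2 / pi) int_0^oo x^2 / (x^2 + y^2) dy as a Riemann sum of step h, truncated after M ~ sqrt n terms, transfers this to |X|_kk: the discretisation costs O(q), the standard deviation of the sum is O(q), and its mean is (4/3) sqrt n + O(q).

For the median eigenvalues, let c = 32 h and let r be the function equal to - 1 below 0, to 1 above c and affine in between. If lam_{n/2+1} > c then tr r(X) >= 0. By the symmetry X -> - X the mean of tr r(X) is minus the expected sum of the tents (1 - |lam|/c)_+, at most - q^3 by the resolvent estimates, while tr r(X) is a difference of two convex functions of X, so its variance is O(n / c^2). Hence the event has probability O(1 / n).

Altogether E (X^+_kk - 4/(3 pi) sqrt n)^2 = O(sqrt n), which contains both claims. *)

(** * Expectation and variance on the discrete cube *)

Section Expectation.
Variables (R : realType) (n : nat).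
Implicit Types (f g : Omega n -> R) (s : Omega n).

Lemma card_Omega_gt0 : 0 < #|{: Omega n}|%:R :> R.
Proof. by rewrite ltr0n; apply/card_gt0P; exists [ffun=> true]. Qed.

Lemma eq_Expect f g : f =1 g -> Expect f = Expect g.
Proof. by move=> fg; rewrite /Expect (eq_bigr g) // => s _; apply: fg. Qed.

Lemma ExpectD f g : Expect (fun s => f s + g s) = Expect f + Expect g.
Proof. by rewrite /Expect big_split mulrDl. Qed.

Lemma ExpectZ a f : Expect (fun s => a * f s) = a * Expect f.
Proof. by rewrite /Expect -mulr_sumr mulrA. Qed.

Lemma ExpectN f : Expect (fun s => - f s) = - Expect f.
Proof. by rewrite /Expect sumrN mulNr. Qed.

Lemma ExpectB f g : Expect (fun s => f s - g s) = Expect f - Expect g.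
Proof. by rewrite ExpectD ExpectN. Qed.

Lemma Expect_const c : Expect (fun _ : Omega n => c : R) = c.
Proof.
rewrite /Expect sumr_const -[c *+ _]mulr_natr -mulrA divff ?mulr1 //.
by rewrite gt_eqF ?card_Omega_gt0.
Qed.

Lemma Expect_sum (I : Type) (r : seq I) (P : pred I) (F : I -> Omega n -> R) :
  Expect (fun s => \sum_(i <- r | P i) F i s) = \sum_(i <- r | P i) Expect (F i).
Proof. by rewrite /Expect exchange_big /= mulr_suml. Qed.

Lemma le_Expect f g : (forall s, f s <= g s) -> Expect f <= Expect g.
Proof.
move=> fg; rewrite ler_wpM2r ?invr_ge0 ?ler0n //.
by apply: ler_sum => s _; apply: fg.
Qed.

Lemma Expect_ge0 f : (forall s, 0 <= f s) -> 0 <= Expect f.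
Proof. by move=> f0; rewrite -(Expect_const 0) le_Expect. Qed.

Lemma Expect_le_const f c : (forall s, f s <= c) -> Expect f <= c.
Proof. by move=> fc; rewrite -[leRHS](Expect_const c) le_Expect. Qed.

Lemma ler_norm_Expect f : `|Expect f| <= Expect (fun s => `|f s|).
Proof.
rewrite /Expect normrM [`|_^-1|]ger0_norm ?invr_ge0 ?ler0n //.
by rewrite ler_wpM2r ?invr_ge0 ?ler0n // ler_norm_sum.
Qed.

Lemma Expect_bij (h : Omega n -> Omega n) f :
  injective h -> Expect (fun s => f (h s)) = Expect f.
Proof. by move=> hI; rewrite /Expect [in RHS](reindex_inj hI). Qed.

Definition Variance f : R := Expect (fun s => (f s - Expect f) ^+ 2).

Lemma Variance_ge0 f : 0 <= Variance f.
Proof. by apply: Expect_ge0 => s; rewrite sqr_ge0. Qed.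

Lemma VarianceE f : Variance f = Expect (fun s => f s ^+ 2) - Expect f ^+ 2.
Proof.
rewrite /Variance.
rewrite (eq_Expect (g := fun s => f s ^+ 2 - (2 * Expect f) * f s + Expect f ^+ 2)); last first.
  by move=> s; ring.
by rewrite ExpectD ExpectB ExpectZ Expect_const; ring.
Qed.

Lemma Expect_sqr_le f : Expect f ^+ 2 <= Expect (fun s => f s ^+ 2).
Proof. by rewrite -subr_ge0 -VarianceE Variance_ge0. Qed.

Lemma le_Expect_sqrt f b : 0 <= b -> Expect (fun s => f s ^+ 2) <= b ^+ 2 ->
  Expect (fun s => `|f s|) <= b.
Proof.
move=> b0 fb; rewrite -(@ler_pXn2r _ 2) ?nnegrE //; last exact: Expect_ge0.
apply: le_trans (Expect_sqr_le _) _; apply: le_trans fb.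
by apply: le_Expect => s; rewrite real_normK ?num_real.
Qed.

(** The mean minimises the mean square distance. A second moment about the limiting value
    [4 / (3 pi)] therefore also controls the fluctuations about the mean. *)
Lemma Variance_le f c : Variance f <= Expect (fun s => (f s - c) ^+ 2).
Proof.
rewrite (eq_Expect (f := fun s => (f s - c) ^+ 2)
  (g := fun s => (f s ^+ 2 - (2 * c) * f s) + c ^+ 2)); last by move=> s; ring.
rewrite ExpectD ExpectB ExpectZ Expect_const VarianceE.
by have := sqr_ge0 (Expect f - c); lra.
Qed.

Lemma VarianceZ a f : Variance (fun s => a * f s) = a ^+ 2 * Variance f.
Proof.
by rewrite /Variance -ExpectZ ExpectZ; apply: eq_Expect => s; ring.
Qed.

Lemma Variance_addc a f : Variance (fun s => f s + a) = Variance f.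
Proof.
by rewrite /Variance ExpectD Expect_const; apply: eq_Expect => s; ring.
Qed.

Lemma VarianceB_le f g :
  Variance (fun s => f s - g s) <= 2 * (Variance f + Variance g).
Proof.
rewrite /Variance -ExpectD -ExpectZ; apply: le_Expect => s.
rewrite ExpectB -subr_ge0.
set a := f s - Expect f; set b := g s - Expect g.
have -> : f s - g s - (Expect f - Expect g) = a - b by rewrite /a /b; ring.
have -> : 2 * (a ^+ 2 + b ^+ 2) - (a - b) ^+ 2 = (a + b) ^+ 2 by ring.
exact: sqr_ge0.
Qed.

(* Cauchy-Schwarz with weights [w]; it replaces Minkowski's inequality for standard deviations. *)
Lemma Variance_sum_le m (F : nat -> Omega n -> R) (w : nat -> R) :
  (forall i, 0 < w i) -> (forall i, Variance (F i) <= w i ^+ 2) ->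
  Variance (fun s => \sum_(i < m) F i s) <= (\sum_(i < m) w i) ^+ 2.
Proof.
move=> w0 Fw; elim: m => [|m IHm].
  rewrite /Variance big_ord0 expr0n /=; apply: Expect_le_const => s.
  rewrite big_ord0 (eq_Expect (g := fun=> 0)) ?Expect_const ?subrr ?expr0n //.
  by move=> t; rewrite big_ord0.
set W := \sum_(i < m) w i in IHm *.
set S := (fun s => \sum_(i < m) F i s) in IHm *.
rewrite big_ord_recr /= -/W.
have W0 : 0 <= W by rewrite sumr_ge0 // => i _; apply: ltW.
have wm := w0 m.
have -> : Variance (fun s => \sum_(i < m.+1) F i s) = Variance (fun s => S s + F m s).
  have e s : \sum_(i < m.+1) F i s = S s + F m s by rewrite big_ord_recr.
  by rewrite /Variance (eq_Expect e); apply: eq_Expect => s; rewrite e.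
(* The weights [w m / W] and [W / w m] below need [W > 0]. All [w i] are positive, so [W = 0] only
   happens for the empty sum. *)
have [WE|Wn0] := eqVneq W 0.
  have m0 : m = 0%N.
    case: (m) @W WE {IHm S W0 wm} => // k; rewrite big_ord_recr /= => h.
    have A0 : 0 <= \sum_(i < k) w i by rewrite sumr_ge0 // => i _; apply: ltW.
    by move/eqP: h; rewrite paddr_eq0 ?(ltW (w0 k)) // (gt_eqF (w0 k)) andbF.
  have S0 s : S s = 0 by rewrite /S m0 big_ord0.
  rewrite WE add0r; apply: le_trans (Fw m); rewrite /Variance.
  rewrite (eq_Expect (f := fun s => S s + F m s) (g := F m)); last by move=> s; rewrite S0 add0r.
  by apply: le_Expect => s; rewrite S0 add0r.
have Wp : 0 < W by rewrite lt_def Wn0.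
have key : Variance (fun s => S s + F m s) <=
    (1 + w m / W) * Variance S + (1 + W / w m) * Variance (F m).
  rewrite /Variance -!ExpectZ -ExpectD; apply: le_Expect => s.
  rewrite ExpectD -subr_ge0.
  set a := S s - _; set b := F m s - _.
  have -> : S s + F m s - (Expect S + Expect (F m)) = a + b by rewrite /a /b; ring.
  have -> : (1 + w m / W) * a ^+ 2 + (1 + W / w m) * b ^+ 2 - (a + b) ^+ 2
     = (w m * a - W * b) ^+ 2 / (W * w m) by field; rewrite !gt_eqF.
  by rewrite divr_ge0 ?sqr_ge0 // ltW // mulr_gt0.
apply: le_trans key _.
have -> : (W + w m) ^+ 2 = (1 + w m / W) * W ^+ 2 + (1 + W / w m) * w m ^+ 2.
  by field; rewrite !gt_eqF.
by apply: lerD; rewrite ler_wpM2l // addr_ge0 // divr_ge0 // ltW.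
Qed.

(** * Sign flips and the Efron-Stein inequality *)

Definition flip (b : upair n) s : Omega n :=
  [ffun c => if c == b then ~~ s c else s c].

Lemma flipK b : involutive (flip b).
Proof. by move=> s; apply/ffunP => c; rewrite !ffunE; case: eqP => // _; rewrite negbK. Qed.

Lemma flip_inj b : injective (flip b).
Proof. exact: inv_inj (flipK b). Qed.

Lemma flipC b c s : flip b (flip c s) = flip c (flip b s).
Proof.
by apply/ffunP => d; rewrite !ffunE; case: (d == b); case: (d == c).
Qed.

Lemma Expect_flip b f : Expect (fun s => f (flip b s)) = Expect f.
Proof. exact/Expect_bij/flip_inj. Qed.

Lemma Expect_flip_half b f :
  Expect f = Expect (fun s => 2^-1 * (f s + f (flip b s))).
Proof. by rewrite ExpectZ ExpectD Expect_flip; lra. Qed.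

(** The expected conditional variance of [f] given all signs except the one at [b]: for two equally
    likely values it is a quarter of their squared difference. *)
Definition flip_energy b f : R := Expect (fun s => (f s - f (flip b s)) ^+ 2) / 4.

(** The conditional expectation of [f] given all signs except the one at [b]. *)
Definition flip_avg b f : Omega n -> R := fun s => (f s + f (flip b s)) / 2.

Lemma flip_avg_energy b f :
  Expect (fun s => f s ^+ 2) = Expect (fun s => flip_avg b f s ^+ 2) + flip_energy b f.
Proof.
have e : Expect (fun s => f s ^+ 2) =
  Expect (fun s => 2^-1 * (f s ^+ 2 + f (flip b s) ^+ 2)).
  exact: (Expect_flip_half b).
rewrite e /flip_energy [_ / 4]mulrC -ExpectZ -ExpectD.
by apply: eq_Expect => s; rewrite /flip_avg; field.
Qed.

(** Flips commute and the square is convex, so averaging over one sign cannot raise the energy of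
    another. *)
Lemma flip_energy_avg b c f : flip_energy c (flip_avg b f) <= flip_energy c f.
Proof.
rewrite /flip_energy ler_wpM2r ?invr_ge0 //.
have e : Expect (fun s => (f s - f (flip c s)) ^+ 2) = Expect (fun s => 2^-1 *
   ((f s - f (flip c s)) ^+ 2 + (f (flip b s) - f (flip c (flip b s))) ^+ 2)).
  exact: (Expect_flip_half b).
rewrite {}e; apply: le_Expect => s; rewrite /flip_avg (flipC b c).
set x := f s; set y := f _; set z := f _; set t := f _; rewrite -subr_ge0.
have -> : 2^-1 * ((x - z) ^+ 2 + (y - t) ^+ 2) - ((x + y) / 2 - (z + t) / 2) ^+ 2
  = ((x - z) - (y - t)) ^+ 2 / 4 by field.
by rewrite divr_ge0 ?sqr_ge0.
Qed.

Lemma Expect_flip_avg b f : Expect (flip_avg b f) = Expect f.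
Proof.
rewrite [RHS](Expect_flip_half b); apply: eq_Expect => s.
by rewrite /flip_avg mulrC.
Qed.

Lemma flip_invariant_const f : (forall b s, f (flip b s) = f s) ->
  forall s t, f s = f t.
Proof.
move=> fI s t.
pose d (u v : Omega n) := #|[set c | u c != v c]|.
move E: (d s t) => k; elim: k s E => [|k IHk] s E.
  congr f; apply/ffunP => c; apply/eqP; apply: contraT => ne.
  by have := card0_eq E c; rewrite !inE ne.
have [b] : exists b, b \in [set c | s c != t c].
  by apply/card_gt0P; rewrite -/(d s t) E.
rewrite inE => nb; rewrite -(fI b) IHk //.
move: E; rewrite /d (cardsD1 b) inE nb => -[<-].
apply: eq_card => c; rewrite !inE ffunE; have [->|_] /= := eqVneq c b; last by [].

by move: nb; case: (s b); case: (t b).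
Qed.

Lemma flip_avg_invariant b f s : flip_avg b f (flip b s) = flip_avg b f s.
Proof. by rewrite /flip_avg flipK addrC. Qed.

Lemma flip_avg_invariantW b c f : (forall s, f (flip c s) = f s) ->
  forall s, flip_avg b f (flip c s) = flip_avg b f s.
Proof. by move=> fc s; rewrite /flip_avg flipC !fc. Qed.

(** The signs are averaged out one at a time. Each averaging lowers the second moment by exactly its
    energy, and the energies still to come do not grow. *)
Lemma Efron_Stein f : Variance f <= \sum_(b : upair n) flip_energy b f.
Proof.
(* The list [r] contains every sign on which the function depends; for the empty list the function
   is constant. *)
have gen (r : seq (upair n)) : forall f, (forall c, c \notin r ->
    forall s, f (flip c s) = f s) ->
  Expect (fun s => f s ^+ 2) <= Expect f ^+ 2 + \sum_(b <- r) flip_energy b f.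
  elim: r => [|b r IHr] g gI.
    rewrite big_nil addr0.
    have gc s : g s = g [ffun=> true].
      by apply: flip_invariant_const => c t; apply: gI.
    rewrite (eq_Expect (g := fun=> g [ffun=> true] ^+ 2)) => [|s]; last by rewrite -(gc s).
    by rewrite (eq_Expect gc) !Expect_const.
  rewrite (flip_avg_energy b) big_cons [leRHS]addrCA [leLHS]addrC lerD2l -(Expect_flip_avg b g).
  apply: le_trans (IHr _ _) _ => [c cr|].
    have [->|cb] := eqVneq c b; first exact: flip_avg_invariant.
    by apply: flip_avg_invariantW => s; apply: gI; rewrite inE negb_or cb.
  by rewrite lerD2l; apply: ler_sum => c _; apply: flip_energy_avg.
rewrite VarianceE lerBlDl; apply: gen => c; by rewrite mem_index_enum.
Qed.

(** Exchanging [s] with [flip b s] swaps the positive and negative parts of the difference, so each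
    carries half of the energy. A one-sided bound, such as a subgradient gives, is then enough. *)
Lemma flip_energy_pos b f :
  flip_energy b f = Expect (fun s => Num.max (f s - f (flip b s)) 0 ^+ 2) / 2.
Proof.
pose g s := Num.max (f s - f (flip b s)) 0 ^+ 2.
rewrite /flip_energy -/(Expect g).
suff -> : Expect (fun s => (f s - f (flip b s)) ^+ 2) = Expect g + Expect g by lra.
rewrite -{2}(Expect_flip b g) -ExpectD; apply: eq_Expect => s; rewrite /g flipK.
by case: leP => h1; case: leP => h2; nra.
Qed.

Lemma Chebyshev f c t : 0 < t ->
  Prob R (fun s => t <= `|f s - c|) <= Expect (fun s => (f s - c) ^+ 2) / t ^+ 2.
Proof.
move=> t0; rewrite /Prob /Expect mulrAC ler_wpM2r ?invr_ge0 ?ler0n //.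
rewrite ler_pdivlMr ?exprn_gt0 // -sum1_card natr_sum mulr_suml.
rewrite [leRHS](bigID [pred s | t <= `|f s - c|]) /=.
rewrite -[leLHS]addr0; apply: lerD; last by apply: sumr_ge0 => s _; apply: sqr_ge0.
rewrite [leLHS](eq_bigl [pred s | t <= `|f s - c|]); last by move=> s; rewrite !inE.
apply: ler_sum => s /= h; rewrite mul1r -[leRHS]real_normK ?num_real //.
by rewrite ler_pXn2r ?nnegrE // ltW.
Qed.

End Expectation.

(** * Functional calculus and resolvents *)

Section FunctionalCalculus.
Variables (R : realType) (n : nat).
Implicit Types (X U : 'M[R]_n) (lam : 'rV[R]_n) (g h : R -> R).

Definition fcalc U lam g : 'M[R]_n := U *m diag_mx (map_mx g lam) *m U^T.

Lemma fcalcE U lam g i j :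
  fcalc U lam g i j = \sum_a g (lam 0 a) * (U i a * U j a).
Proof.
rewrite !mxE; apply: eq_bigr => a _; rewrite mul_mx_diag !mxE; ring.
Qed.

Lemma tr_fcalc U lam g : (fcalc U lam g)^T = fcalc U lam g.
Proof.
by apply/matrixP => i j; rewrite mxE !fcalcE; apply: eq_bigr => a _; rewrite [U j a * _]mulrC.
Qed.

Lemma eq_fcalc U lam g h : (forall x, g x = h x) -> fcalc U lam g = fcalc U lam h.
Proof. by move=> gh; apply/matrixP => i j; rewrite !fcalcE; apply: eq_bigr => a _; rewrite gh. Qed.

Lemma fcalcD U lam g h : fcalc U lam g + fcalc U lam h = fcalc U lam (fun x => g x + h x).
Proof.
by apply/matrixP => i j; rewrite mxE !fcalcE -big_split; apply: eq_bigr => a _; rewrite mulrDl.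
Qed.

Lemma fcalcZ U lam c g : c *: fcalc U lam g = fcalc U lam (fun x => c * g x).
Proof.
by apply/matrixP => i j; rewrite mxE !fcalcE mulr_sumr; apply: eq_bigr => a _; rewrite mulrA.
Qed.

Lemma eigdec_fcalc X U lam : is_eigdec X U lam -> X = fcalc U lam id.
Proof.
case=> _ XE _; apply/matrixP => i j; rewrite XE fcalcE summxE.
by apply: eq_bigr => a _; rewrite !mxE big_ord_recl big_ord0 addr0 !mxE.
Qed.

Section Orthogonal.
Variables (U : 'M[R]_n) (lam : 'rV[R]_n).
Hypothesis UU : U^T *m U = 1%:M.

Lemma fcalc1 : fcalc U lam (fun=> 1) = 1%:M.
Proof.
rewrite /fcalc (_ : map_mx _ _ = const_mx 1); last by apply/matrixP => i j; rewrite !mxE.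
by rewrite diag_const_mx mulmx1; apply: mulmx1C.
Qed.

Lemma fcalcM g h : fcalc U lam g *m fcalc U lam h = fcalc U lam (fun x => g x * h x).
Proof.
rewrite /fcalc !mulmxA -[_ *m U^T *m U]mulmxA UU mulmx1 -[U *m _ *m _]mulmxA mulmx_diag.
by congr (_ *m diag_mx _ *m _); apply/matrixP => i j; rewrite (ord1 i) !mxE.
Qed.

Lemma mxtrace_fcalc g : \tr (fcalc U lam g) = \sum_a g (lam 0 a).
Proof.
rewrite /fcalc -mulmxA mxtrace_mulC -mulmxA UU mulmx1 mxtrace_diag.
by apply: eq_bigr => a _; rewrite mxE.
Qed.

Lemma sum_row_sqr k : \sum_a U k a ^+ 2 = 1.
Proof.
have := congr1 (fun A : 'M_n => A k k) fcalc1.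
rewrite fcalcE mxE eqxx mulr1n => <-.
by apply: eq_bigr => a _; rewrite mul1r.
Qed.

End Orthogonal.
End FunctionalCalculus.

(* [K] and [Y] are the real and imaginary parts of the resolvent [(X - i y)^-1]. *)
Definition is_resolvent (R : realType) (n : nat) (X : 'M[R]_n) (y : R) (K Y : 'M[R]_n) : Prop :=
  [/\ K^T = K, Y^T = Y, X *m K + y *: Y = 1%:M & X *m Y = y *: K].

(** [reK] and [imY] are the real and imaginary parts of [1 / (x - i y)]. *)
Definition reK (R : realType) (y : R) : R -> R := fun x => x / (x ^+ 2 + y ^+ 2).
Definition imY (R : realType) (y : R) : R -> R := fun x => y / (x ^+ 2 + y ^+ 2).

Lemma sqrDsqr_gt0 (R : realType) (x y : R) : 0 < y -> 0 < x ^+ 2 + y ^+ 2.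
Proof. by move=> y0; rewrite ltr_wpDl ?sqr_ge0 ?exprn_gt0. Qed.

Lemma fcalc_resolvent (R : realType) (n : nat) (X U : 'M[R]_n) lam (y : R) :
  is_eigdec X U lam -> 0 < y ->
  is_resolvent X y (fcalc U lam (reK y)) (fcalc U lam (imY y)).
Proof.
move=> dec y0; have [UU _ _] := dec.
split; rewrite ?tr_fcalc // [X in X *m _](eigdec_fcalc dec) fcalcM // fcalcZ.
- rewrite fcalcD -(fcalc1 lam UU); apply: eq_fcalc => x.
  by rewrite /reK /imY; field; rewrite gt_eqF // sqrDsqr_gt0.
- by apply: eq_fcalc => x; rewrite /reK /imY; field; rewrite gt_eqF // sqrDsqr_gt0.
Qed.

(** * Resolvent identities and entrywise bounds *)

Section Resolvent.
Variables (R : realType) (n : nat) (y : R).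
Hypothesis y0 : 0 < y.
Implicit Types (X K Y : 'M[R]_n).

Lemma resolvent_l X K Y : X^T = X -> is_resolvent X y K Y ->
  K *m X + y *: Y = 1%:M /\ Y *m X = y *: K.
Proof.
move=> XT [KT YT XK XY]; split.
  by have := congr1 trmx XK; rewrite linearD linearZ /= trmx_mul KT YT XT trmx1.
by have := congr1 trmx XY; rewrite linearZ /= trmx_mul KT YT XT.
Qed.

(** Real and imaginary parts of the resolvent identity [G - G' = G (X' - X) G'], with
    [G = K + i Y]. *)
Lemma resolventB X X' K Y K' Y' : X^T = X ->
  is_resolvent X y K Y -> is_resolvent X' y K' Y' ->
  K - K' = K *m (X' - X) *m K' - Y *m (X' - X) *m Y' /\
  Y - Y' = K *m (X' - X) *m Y' + Y *m (X' - X) *m K'.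
Proof.
move=> XT rX [_ _ XK' XY'].
have [KX YX] := resolvent_l XT rX.
have {}KX : K *m X = 1%:M - y *: Y by rewrite -KX addrK.
have {}XK' : X' *m K' = 1%:M - y *: Y' by rewrite -XK' addrK.
rewrite !mulmxBr !mulmxBl -!(mulmxA _ X') XK' XY' KX YX.
rewrite !mulmxBr !mulmxBl !mulmx1 !mul1mx -?scalemxAl -?scalemxAr.
by split; apply/matrixP => i j; rewrite !mxE; ring.
Qed.

(** An eigendecomposition is chosen separately for each sample; this shows that the resolvent
    depends on the matrix alone, so that samples can be compared. *)
Lemma resolvent_uniq X K Y K' Y' : X^T = X ->
  is_resolvent X y K Y -> is_resolvent X y K' Y' -> K = K' /\ Y = Y'.
Proof.
move=> XT r r'; have [] := resolventB XT r r'.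
rewrite !subrr !mulmx0 !mul0mx subrr addr0.
by move=> /subr0_eq -> /subr0_eq ->.
Qed.

Lemma resolventN X K Y : is_resolvent X y K Y -> is_resolvent (- X) y (- K) Y.
Proof.
case=> KT YT XK XY; split=> //; first by rewrite linearN /= KT.
  by rewrite mulNmx mulmxN opprK.
by rewrite mulNmx XY scalerN.
Qed.

Section Bounds.
Variables (X K Y : 'M[R]_n).
Hypothesis XT : X^T = X.
Hypothesis rX : is_resolvent X y K Y.

Lemma resolvent_symK i j : K i j = K j i.
Proof. by case: rX => KT _ _ _; rewrite -[in LHS]KT mxE. Qed.

Lemma resolvent_symY i j : Y i j = Y j i.
Proof. by case: rX => _ YT _ _; rewrite -[in LHS]YT mxE. Qed.

(** The Ward identity [G G* = Im G / y]. Its diagonal bounds the squared norm of a row by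
    [Y k k / y], with no factor [n]. *)
Lemma resolvent_sqr : K *m K + Y *m Y = y^-1 *: Y.
Proof.
have [_ _ XK XY] := rX; have [KX YX] := resolvent_l XT rX.
have : Y *m (X *m K + y *: Y) = Y by rewrite XK mulmx1.
rewrite mulmxDr mulmxA YX -scalemxAl -scalemxAr -scalerDr => e.
by rewrite -[in RHS]e scalerA mulVf ?scale1r // gt_eqF.
Qed.

Lemma sum_row_resolvent k : \sum_j (K k j ^+ 2 + Y k j ^+ 2) = Y k k / y.
Proof.
have := congr1 (fun A : 'M_n => A k k) resolvent_sqr.
rewrite !mxE [RHS]mulrC => <-; rewrite -big_split; apply: eq_bigr => j _ /=.
by rewrite (resolvent_symK j k) (resolvent_symY j k) !expr2.
Qed.

Lemma resolvent_Y_ge0 k : 0 <= Y k k.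
Proof.
suff : 0 <= Y k k / y by rewrite pmulr_lge0 // invr_gt0.
rewrite -sum_row_resolvent; apply: sumr_ge0 => j _.
by rewrite addr_ge0 ?sqr_ge0.
Qed.

Lemma entry_le_row k j : K k j ^+ 2 + Y k j ^+ 2 <= Y k k / y.
Proof.
rewrite -sum_row_resolvent (bigD1 j) //= lerDl; apply: sumr_ge0 => i _.
by rewrite addr_ge0 ?sqr_ge0.
Qed.

(** The Ward identity gives [(Y k k)^2 <= Y k k / y], and one factor cancels. *)
Lemma resolvent_Y_le k : Y k k <= y^-1.
Proof.
have h := entry_le_row k k; have h0 := resolvent_Y_ge0 k.
have h1 : Y k k * Y k k <= Y k k / y by have := sqr_ge0 (K k k); nra.
have [->|ne] := eqVneq (Y k k) 0; first by rewrite invr_ge0 ltW.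
by move: h1; rewrite ler_pM2l // lt_def ne.
Qed.

Lemma sum_row_resolvent_le k : \sum_j (K k j ^+ 2 + Y k j ^+ 2) <= y^-1 ^+ 2.
Proof.
rewrite sum_row_resolvent expr2 ler_wpM2r ?invr_ge0 ?(ltW y0) //.
exact: resolvent_Y_le.
Qed.

Lemma entry_resolvent_le k j : K k j ^+ 2 + Y k j ^+ 2 <= y^-1 ^+ 2.
Proof.
apply: le_trans (sum_row_resolvent_le k); rewrite sum_row_resolvent.
exact: entry_le_row.
Qed.

Lemma normK_le k j : `|K k j| <= y^-1.
Proof.
rewrite -(@ler_pXn2r _ 2) ?nnegrE ?invr_ge0 ?(ltW y0) // real_normK ?num_real //.
by have := entry_resolvent_le k j; have := sqr_ge0 (Y k j); lra.
Qed.

Lemma normY_le k j : `|Y k j| <= y^-1.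
Proof.
rewrite -(@ler_pXn2r _ 2) ?nnegrE ?invr_ge0 ?(ltW y0) // real_normK ?num_real //.
by have := entry_resolvent_le k j; have := sqr_ge0 (K k j); lra.
Qed.

(** Cauchy-Schwarz for a row of norm at most [1 / y], where [b] stands for the square root of
    [n]. *)
Lemma sum_row_norm_le k (b : R) : 0 <= b -> b ^+ 2 = n%:R ->
  \sum_j (`|K k j| + `|Y k j|) <= 2 * b / y.
Proof.
move=> b0 bn.
have [b00|bn0] := eqVneq b 0.
  have n0 : n = 0%N by apply/eqP; rewrite -(@eqr_nat R) -bn b00 expr0n.
  by exfalso; case: k => k; rewrite n0.
have bp : 0 < b by rewrite lt_def bn0.
(* AM-GM: [2 |u| <= b y u^2 + 1 / (b y)] *)
have amgm (u : R) : `|u| <= (b * y * u ^+ 2 + (b * y)^-1) / 2.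
  have byp : 0 < b * y by rewrite mulr_gt0.
  rewrite -[u ^+ 2]real_normK ?num_real // -subr_ge0.
  have -> : (b * y * `|u| ^+ 2 + (b * y)^-1) / 2 - `|u| = (b * y * `|u| - 1) ^+ 2 / (b * y) / 2.
    by field; rewrite !gt_eqF.
  by rewrite !divr_ge0 ?sqr_ge0 // ltW.
have -> : 2 * b / y = b * y / 2 * (y^-1 ^+ 2) + n%:R * ((b * y)^-1) + b / 2 / y.
  by rewrite -bn; field; rewrite !gt_eqF.
apply: (@le_trans _ _ (\sum_j (b * y / 2 * (K k j ^+ 2 + Y k j ^+ 2) + (b * y)^-1))).
  by apply: ler_sum => j _; have := amgm (K k j); have := amgm (Y k j); lra.
rewrite big_split /= -mulr_sumr sumr_const card_ord -[_ *+ n]mulr_natl.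
rewrite -[leLHS]addr0 !lerD //; last by rewrite !divr_ge0 // ltW.
by rewrite ler_wpM2l ?sum_row_resolvent_le // divr_ge0 // mulr_ge0 // ltW.
Qed.

End Bounds.

(** For symmetric [X] and [i != j] this negates the entries at [i j] and [j i]; written as a
    perturbation of rank two it fits the resolvent identity. *)
Definition flip_mx X (i j : 'I_n) : 'M[R]_n :=
  X - (2 * X i j) *: (delta_mx i j + delta_mx j i).

Lemma mul_delta_mul (A B : 'M[R]_n) i j a b :
  (A *m (delta_mx i j + delta_mx j i) *m B) a b = A a i * B j b + A a j * B i b.
Proof.
have h (p q : 'I_n) : (A *m delta_mx p q *m B) a b = A a p * B q b.
  rewrite mxE (bigD1 q) //= big1 ?addr0 => [|r rq].
    congr (_ * _); rewrite mxE (bigD1 p) //= big1 ?addr0 => [|r rp].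
      by rewrite mxE !eqxx mulr1.
    by rewrite mxE (negbTE rp) mulr0.
  rewrite mxE big1 ?mul0r // => s _; by rewrite mxE (negbTE rq) andbF mulr0.
by rewrite mulmxDr mulmxDl mxE !h.
Qed.

Section Flip.
Variables (X K Y K' Y' : 'M[R]_n) (i j : 'I_n).
Hypothesis XT : X^T = X.
Hypothesis X1 : X i j ^+ 2 = 1.
Hypothesis rX : is_resolvent X y K Y.
Hypothesis rX' : is_resolvent (flip_mx X i j) y K' Y'.
Hypothesis XT' : (flip_mx X i j)^T = flip_mx X i j.

Lemma flip_mxB : flip_mx X i j - X = - (2 * X i j) *: (delta_mx i j + delta_mx j i).
Proof. by rewrite /flip_mx addrC addKr scaleNr. Qed.

Lemma flip_resolventK a b : K a b - K' a b =
  - (2 * X i j) * (K a i * K' j b + K a j * K' i b - (Y a i * Y' j b + Y a j * Y' i b)).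
Proof.
have [e _] := resolventB XT rX rX'.
have := congr1 (fun A : 'M_n => A a b) e.
rewrite flip_mxB -!scalemxAr -!scalemxAl.
move: (mul_delta_mul K K' i j a b) (mul_delta_mul Y Y' i j a b).
move: (K *m _ *m K') (Y *m _ *m Y') => A B h1 h2.
by rewrite !mxE h1 h2 => ->; ring.
Qed.

Lemma flip_resolventY a b : Y a b - Y' a b =
  - (2 * X i j) * (K a i * Y' j b + K a j * Y' i b + (Y a i * K' j b + Y a j * K' i b)).
Proof.
have [_ e] := resolventB XT rX rX'.
have := congr1 (fun A : 'M_n => A a b) e.
rewrite flip_mxB -!scalemxAr -!scalemxAl.
move: (mul_delta_mul K Y' i j a b) (mul_delta_mul Y K' i j a b).
move: (K *m _ *m Y') (Y *m _ *m K') => A B h1 h2.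
by rewrite !mxE h1 h2 => ->; ring.
Qed.

Lemma norm2X : `|2 * X i j| = 2.
Proof.
by apply/eqP; rewrite -(@eqrXn2 _ 2) // real_normK ?num_real // exprMn X1; apply/eqP; ring.
Qed.

Lemma sum_mul_row_le (A A' B B' : 'M[R]_n) c p q (e1 e2 : R) : `|e1| = 1 -> `|e2| = 1 ->
  \sum_a (A p a ^+ 2 + A' p a ^+ 2) <= c -> \sum_a (B q a ^+ 2 + B' q a ^+ 2) <= c ->
  `|\sum_a (A p a * B q a * e1 + A' p a * B' q a * e2)| <= c.
Proof.
move=> e11 e21 h1 h2; apply: le_trans (ler_norm_sum _ _ _) _.
apply: (@le_trans _ _ (\sum_a (2^-1 * (A p a ^+ 2 + A' p a ^+ 2) + 2^-1 * (B q a ^+ 2 + B' q a ^+ 2)))).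
  apply: ler_sum => a _; apply: le_trans (ler_normD _ _) _.
  rewrite !normrM e11 e21 !mulr1.
  rewrite -[A p a ^+ 2]real_normK -1?[A' p a ^+ 2]real_normK ?num_real //.
  rewrite -[B q a ^+ 2]real_normK -1?[B' q a ^+ 2]real_normK ?num_real //.
  have := sqr_ge0 (`|A p a| - `|B q a|); have := sqr_ge0 (`|A' p a| - `|B' q a|).
  by nra.
rewrite big_split /= -!mulr_sumr; lra.
Qed.

Let rowX p := sum_row_resolvent_le XT rX p.
Let rowX' p := sum_row_resolvent_le XT' rX' p.

(** A perturbation of rank two turns the trace of the difference into inner products of rows of the
    two resolvents. Each row has norm at most [1 / y], so the bound is free of [n]. *)
Lemma flip_traceK : `|\tr K - \tr K'| <= 4 / y ^+ 2.
Proof.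
rewrite /mxtrace -sumrB (eq_bigr _ (fun a _ => flip_resolventK a a)) -mulr_sumr.
rewrite normrM normrN norm2X.
rewrite (_ : 4 / y ^+ 2 = 2 * (y^-1 ^+ 2 + y^-1 ^+ 2)); last by field; rewrite gt_eqF.
rewrite ler_pM2l //.
have e a : K a i * K' j a + K a j * K' i a - (Y a i * Y' j a + Y a j * Y' i a) =
  (K i a * K' j a * 1 + Y i a * Y' j a * -1) + (K j a * K' i a * 1 + Y j a * Y' i a * -1).
  by rewrite !(resolvent_symK rX a) !(resolvent_symY rX a); ring.
rewrite (eq_bigr _ (fun a _ => e a)) big_split /=.
apply: le_trans (ler_normD _ _) _.
by apply: lerD; apply: sum_mul_row_le; rewrite ?normrN ?normr1.
Qed.

Lemma flip_traceY : `|\tr Y - \tr Y'| <= 4 / y ^+ 2.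
Proof.
rewrite /mxtrace -sumrB (eq_bigr _ (fun a _ => flip_resolventY a a)) -mulr_sumr.
rewrite normrM normrN norm2X.
rewrite (_ : 4 / y ^+ 2 = 2 * (y^-1 ^+ 2 + y^-1 ^+ 2)); last by field; rewrite gt_eqF.
rewrite ler_pM2l //.
have e a : K a i * Y' j a + K a j * Y' i a + (Y a i * K' j a + Y a j * K' i a) =
  (K i a * Y' j a * 1 + Y i a * K' j a * 1) + (K j a * Y' i a * 1 + Y j a * K' i a * 1).
  by rewrite !(resolvent_symK rX a) !(resolvent_symY rX a); ring.
rewrite (eq_bigr _ (fun a _ => e a)) big_split /=.
apply: le_trans (ler_normD _ _) _.
apply: lerD; apply: sum_mul_row_le; rewrite ?normr1 //.
  by under eq_bigr do rewrite addrC.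
by under eq_bigr do rewrite addrC.
Qed.

End Flip.
End Resolvent.

(** * Flipping one sign *)

Section FlipEntries.
Variables (R : realType) (n : nat) (y : R).
Hypothesis y0 : 0 < y.
Variables (X K Y K' Y' : 'M[R]_n) (i j : 'I_n).
Hypothesis XT : X^T = X.
Hypothesis X1 : X i j ^+ 2 = 1.
Hypothesis rX : is_resolvent X y K Y.
Hypothesis rX' : is_resolvent (flip_mx X i j) y K' Y'.
Hypothesis XT' : (flip_mx X i j)^T = flip_mx X i j.

Let nK := normK_le y0 XT rX.
Let nY := normY_le y0 XT rX.
Let nK' := normK_le y0 XT' rX'.
Let nY' := normY_le y0 XT' rX'.

Lemma norm_sum4_le (a b c d a' b' c' d' : R) (w : R) :
  `|a| <= w -> `|b| <= w -> `|c| <= w -> `|d| <= w ->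
  `|a * a' + b * b' + (c * c' + d * d')| <= w * (`|a'| + `|b'| + (`|c'| + `|d'|)).
Proof.
move=> h1 h2 h3 h4; rewrite !mulrDr.
apply: le_trans (ler_normD _ _) _; apply: lerD.
  by apply: le_trans (ler_normD _ _) _; rewrite !normrM; apply: lerD; apply: ler_wpM2r.
by apply: le_trans (ler_normD _ _) _; rewrite !normrM; apply: lerD; apply: ler_wpM2r.
Qed.

(** The entries of the original resolvent are bounded crudely by [1 / y]; only the flipped entries
    in column [k] are kept. *)
Lemma flip_entry_le c k :
  `|K c k - K' c k| + `|Y c k - Y' c k| <=
  (4 / y) * (`|K' i k| + `|Y' i k| + (`|K' j k| + `|Y' j k|)).
Proof.
rewrite (flip_resolventK XT rX rX') (flip_resolventY XT rX rX').
rewrite !normrM !normrN (norm2X X1) opprD -!mulrN.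
have h1 := norm_sum4_le (K' j k) (K' i k) (- Y' j k) (- Y' i k)
  (nK c i) (nK c j) (nY c i) (nY c j).
have h2 := norm_sum4_le (Y' j k) (Y' i k) (K' j k) (K' i k)
  (nK c i) (nK c j) (nY c i) (nY c j).
rewrite !normrN in h1.
apply: le_trans (_ : _ <= 2 * (y^-1 * (`|K' j k| + `|K' i k| + (`|Y' j k| + `|Y' i k|)))
   + 2 * (y^-1 * (`|Y' j k| + `|Y' i k| + (`|K' j k| + `|K' i k|)))) _.
  by rewrite -!mulrDr in h1 h2 *; lra.
by rewrite le_eqVlt; apply/orP; left; apply/eqP; field; rewrite gt_eqF.
Qed.

Lemma flip_diag_le (k : 'I_n) : i = k ->
  `|K k k - K' k k| <= (2 / y) * (`|K k j| + `|Y k j| + (`|K' k j| + `|Y' k j|)) /\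
  `|Y k k - Y' k k| <= (2 / y) * (`|K k j| + `|Y k j| + (`|K' k j| + `|Y' k j|)).
Proof.
move=> ik; subst k.
rewrite (flip_resolventK XT rX rX') (flip_resolventY XT rX rX').
rewrite !normrM !normrN (norm2X X1) opprD -!mulrN.
rewrite (resolvent_symK rX' j i) (resolvent_symY rX' j i).
rewrite ![K i j * _]mulrC ![Y i j * _]mulrC.
have nN (A : R) : `|A| <= y^-1 -> `|- A| <= y^-1 by rewrite normrN.
have h1 := norm_sum4_le (K' i j) (K i j) (- Y' i j) (Y i j)
  (nK i i) (nK' i i) (nY i i) (nN _ (nY' i i)).
have h2 := norm_sum4_le (Y' i j) (K i j) (K' i j) (Y i j)
  (nK i i) (nY' i i) (nY i i) (nK' i i).
rewrite !normrN in h1.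
by split; rewrite -mulrA ler_pM2l //; [apply: le_trans h1 _|apply: le_trans h2 _];
  rewrite ler_pM2l ?invr_gt0 //; lra.
Qed.

(** The bound mentions only the original resolvent at [k i] and [k j], so that the row bound applies
    when it is summed over [i] and [j]. The flipped entries are eliminated with [flip_entry_le]. *)
Lemma flip_Ykk_sqr_le k : 16 <= y ->
  (Y k k - Y' k k) ^+ 2 <=
   128 * ((K k i ^+ 2 + Y k i ^+ 2) * (K k j ^+ 2 + Y k j ^+ 2))
   + 16384 / y ^+ 4 * ((K k i ^+ 2 + Y k i ^+ 2) + (K k j ^+ 2 + Y k j ^+ 2)).
Proof.
move=> y16.
have hi : `|K i k - K' i k| + `|Y i k - Y' i k| <=
  (4 / y) * (`|K' i k| + `|Y' i k| + (`|K' j k| + `|Y' j k|)).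
  exact: flip_entry_le.
have hj : `|K j k - K' j k| + `|Y j k - Y' j k| <=
  (4 / y) * (`|K' i k| + `|Y' i k| + (`|K' j k| + `|Y' j k|)).
  exact: flip_entry_le.
rewrite (flip_resolventY XT rX rX').
rewrite !(resolvent_symK rX k) !(resolvent_symY rX k).
have si := entry_resolvent_le y0 XT rX i k.
have sj := entry_resolvent_le y0 XT rX j k.
have e : - (2 * X i j) * (K i k * Y' j k + K j k * Y' i k + (Y i k * K' j k + Y j k * K' i k))
  = - (2 * X i j) * ((K i k * Y' j k + Y i k * K' j k) + (K j k * Y' i k + Y j k * K' i k)) by ring.
rewrite {}e exprMn sqrrN exprMn X1.
move: (K i k) (K' i k) (Y i k) (Y' i k) (K j k) (K' j k) (Y j k) (Y' j k) hi hj si sj.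
move=> p p' q q' u u' v v' hi hj si sj.
pose a := `|p| + `|q|; pose a' := `|p'| + `|q'|.
pose b := `|u| + `|v|; pose b' := `|u'| + `|v'|.
have z0 : 0 < y^-1 by rewrite invr_gt0.
have z16 : 16 * y^-1 <= 1 by rewrite ler_pdivrMr // mul1r.
have ha : a' <= a + 4 / y * (a' + b').
  have := ler_distD p p' 0; have := ler_distD q q' 0; rewrite !subr0.
  by rewrite [`|p' - p|]distrC [`|q' - q|]distrC /a /a' /b'; lra.
have hb : b' <= b + 4 / y * (a' + b').
  have := ler_distD u u' 0; have := ler_distD v v' 0; rewrite !subr0.
  by rewrite [`|u' - u|]distrC [`|v' - v|]distrC /b /a' /b'; lra.
have a0 : 0 <= a by rewrite addr_ge0. have a'0 : 0 <= a' by rewrite addr_ge0.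
have b0 : 0 <= b by rewrite addr_ge0. have b'0 : 0 <= b' by rewrite addr_ge0.
(* Adding [ha] and [hb] gives [(1 - 8 / y) (a' + b') <= a + b], and [8 / y <= 1 / 2] because
   [y >= 16]. *)
have S2 : a' + b' <= 2 * (a + b) by nra.
have {}ha : a' <= a + 8 / y * (a + b) by nra.
have {}hb : b' <= b + 8 / y * (a + b) by nra.
have a2 : a ^+ 2 <= 2 * (p ^+ 2 + q ^+ 2).
  rewrite /a -(real_normK (num_real p)) -(real_normK (num_real q)).
  by have := sqr_ge0 (`|p| - `|q|); nra.
have b2 : b ^+ 2 <= 2 * (u ^+ 2 + v ^+ 2).
  rewrite /b -(real_normK (num_real u)) -(real_normK (num_real v)).
  by have := sqr_ge0 (`|u| - `|v|); nra.
set D := _ + _ + (_ + _).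
have D1 : `|D| <= a * b' + b * a'.
  apply: le_trans (ler_normD _ _) _; apply: lerD; apply: le_trans (ler_normD _ _) _;
  rewrite !normrM /a /b /a' /b' mulrDl; apply: lerD; apply: ler_wpM2l => //; rewrite ?lerDl ?lerDr //.
have D2 : `|D| <= 2 * (a * b) + 8 / y * (a + b) ^+ 2.
  apply: le_trans D1 _.
  have := ler_wpM2l a0 hb; have := ler_wpM2l b0 ha; lra.
have D3 : `|D| <= 2 * (a * b) + 16 / y * (a ^+ 2 + b ^+ 2).
  apply: le_trans D2 _; rewrite lerD2l.
  have -> : 16 / y * (a ^+ 2 + b ^+ 2) = 8 / y * (2 * (a ^+ 2 + b ^+ 2)) by ring.
  rewrite ler_wpM2l ?divr_ge0 ?(ltW y0) //.
  by have := sqr_ge0 (a - b); lra.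
set P := p ^+ 2 + q ^+ 2 in si a2 *; set Q := u ^+ 2 + v ^+ 2 in sj b2 *.
have P0 : 0 <= P by rewrite addr_ge0 ?sqr_ge0.
have Q0 : 0 <= Q by rewrite addr_ge0 ?sqr_ge0.
(* The constants [8] and [1024] come from two uses of [(u + v)^2 <= 2 u^2 + 2 v^2]. *)
have D4 : D ^+ 2 <= 8 * (a ^+ 2 * b ^+ 2) + 1024 * y^-1 ^+ 2 * ((a ^+ 2) ^+ 2 + (b ^+ 2) ^+ 2).
  rewrite -(real_normK (num_real D)).
  apply: (@le_trans _ _ ((2 * (a * b) + 16 / y * (a ^+ 2 + b ^+ 2)) ^+ 2)).
    by rewrite ler_pXn2r ?nnegrE // (le_trans _ D3).
  have := sqr_ge0 (2 * (a * b) - 16 / y * (a ^+ 2 + b ^+ 2)).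
  have := mulr_ge0 (sqr_ge0 (16 / y)) (sqr_ge0 (a ^+ 2 - b ^+ 2)).
  lra.
have a4 : (a ^+ 2) ^+ 2 <= 4 * y^-1 ^+ 2 * P.
  apply: (@le_trans _ _ ((2 * P) ^+ 2)); first by rewrite ler_pXn2r ?nnegrE ?sqr_ge0 // mulr_ge0.
  by have := ler_wpM2r P0 si; lra.
have b4 : (b ^+ 2) ^+ 2 <= 4 * y^-1 ^+ 2 * Q.
  apply: (@le_trans _ _ ((2 * Q) ^+ 2)); first by rewrite ler_pXn2r ?nnegrE ?sqr_ge0 // mulr_ge0.
  by have := ler_wpM2r Q0 sj; lra.
have ab : a ^+ 2 * b ^+ 2 <= 4 * (P * Q).
  have := ler_pM (sqr_ge0 a) (sqr_ge0 b) a2 b2; lra.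
have y4 : 16384 / y ^+ 4 * (P + Q) = 4 * (1024 * y^-1 ^+ 2 * (4 * y^-1 ^+ 2 * P + 4 * y^-1 ^+ 2 * Q)).
  by rewrite exprVn; field; rewrite gt_eqF.
rewrite {}y4.
have : 1024 * y^-1 ^+ 2 * ((a ^+ 2) ^+ 2 + (b ^+ 2) ^+ 2) <=
  1024 * y^-1 ^+ 2 * (4 * y^-1 ^+ 2 * P + 4 * y^-1 ^+ 2 * Q).
  by apply: ler_wpM2l; [rewrite mulr_ge0 ?sqr_ge0|apply: lerD].
lra.
Qed.

End FlipEntries.

(** * Sign matrices under flips and negation *)

Section SignMatrix.
Variables (R : realType) (n : nat).
Implicit Types (s : Omega n) (b : upair n) (i j k : 'I_n).

Lemma signmx_lt s (b : upair n) :
  signmx R s (val b).1 (val b).2 = if s b then 1 else -1.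
Proof.
rewrite mxE; case: b => -[i j] /= ij; rewrite ij /sgn_at insubT //=.
Qed.

Lemma signmx_symE s i j : signmx R s i j = signmx R s j i.
Proof. by rewrite !mxE; case: (ltngtP i j). Qed.

Lemma tr_signmx s : (signmx R s)^T = signmx R s.
Proof. by apply/matrixP => i j; rewrite mxE signmx_symE. Qed.

Lemma signmx_diag s k : signmx R s k k = 0.
Proof. by rewrite mxE ltnn. Qed.

Lemma upair_of i j : i != j -> exists b : upair n, val b = (i, j) \/ val b = (j, i).
Proof.
rewrite -val_eqE /= neq_ltn => /orP[h|h].
  by exists (exist _ (i, j) h); left.
by exists (exist _ (j, i) h); right.
Qed.

Lemma signmx_sqr s i j : i != j -> signmx R s i j ^+ 2 = 1.
Proof.
move=> /upair_of[b [e|e]]; [|rewrite signmx_symE];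
  by have := signmx_lt s b; rewrite e /= => ->; case: (s b); rewrite ?sqrrN expr1n.
Qed.

Lemma flip_mxC (X : 'M[R]_n) i j : X^T = X -> flip_mx X i j = flip_mx X j i.
Proof.
move=> XT; have -> : flip_mx X i j = X - (2 * X^T j i) *: (delta_mx i j + delta_mx j i).
  by rewrite mxE.
by rewrite XT /flip_mx [delta_mx i j + _]addrC.
Qed.

Lemma signmx_ext s (X : 'M[R]_n) : X^T = X -> (forall k, X k k = 0) ->
  (forall b : upair n, signmx R s (val b).1 (val b).2 = X (val b).1 (val b).2) ->
  signmx R s = X.
Proof.
move=> XT X0 h; apply/matrixP => i j.
have [<-|ij] := eqVneq i j; first by rewrite signmx_diag X0.
have [b [e|e]] := upair_of ij; have := h b; rewrite e //=.
by rewrite signmx_symE => ->; rewrite -[in LHS]XT mxE.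
Qed.

Lemma signmx_flip (b : upair n) s :
  signmx R (flip b s) = flip_mx (signmx R s) (val b).1 (val b).2.
Proof.
have bne : (val b).1 != (val b).2 by rewrite -val_eqE /= neq_ltn (valP b).
apply: signmx_ext.
- rewrite /flip_mx linearB linearZ /= linearD /= !trmx_delta tr_signmx.
  by rewrite [delta_mx _ _ + _]addrC.
- move=> k; have nd (p q : 'I_n) : p != q -> (delta_mx p q : 'M[R]_n) k k = 0.
    move=> pq; rewrite mxE; have [kp|//] := eqVneq k p.
    by rewrite kp (negbTE pq).
  rewrite /flip_mx mxE signmx_diag [(- _ : 'M_n) _ _]mxE [(_ *: _ : 'M_n) _ _]mxE.
  by rewrite [(_ + _ : 'M_n) _ _]mxE !nd ?addr0 ?mulr0 ?subr0 // eq_sym.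
- move=> c; rewrite signmx_lt ffunE /flip_mx mxE [(- _ : 'M_n) _ _]mxE [(_ *: _ : 'M_n) _ _]mxE [(_ + _ : 'M_n) _ _]mxE !signmx_lt.
  rewrite !mxE.
  have -> : ((val c).1 == (val b).2) && ((val c).2 == (val b).1) = false.
    apply/andP => -[/eqP h1 /eqP h2]; have := valP c; have := valP b.
    by rewrite /= h1 h2 => /ltn_trans h /h; rewrite ltnn.
  have -> : ((val c).1 == (val b).1) && ((val c).2 == (val b).2) = (c == b).
    by rewrite -[c == b]val_eqE; case: (val c) => ? ?; case: (val b) => ? ?; rewrite xpair_eqE.
  have [->|_] := eqVneq c b; last by rewrite addr0 mulr0 oppr0 addr0 /=; case: (s c).
  by case: (s b) => /=; ring.
Qed.

Lemma flip_of_pair i j : i != j ->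
  exists b : upair n, forall s, signmx R (flip b s) = flip_mx (signmx R s) i j.
Proof.
move=> /upair_of[b e]; exists b => s; rewrite signmx_flip.
by case: e => ->; rewrite //= flip_mxC // tr_signmx.
Qed.

Definition neg s : Omega n := [ffun c => ~~ s c].

Lemma neg_inj : injective neg.
Proof.
by apply: inv_inj => s; apply/ffunP => c; rewrite !ffunE negbK.
Qed.

Lemma signmx_neg s : signmx R (neg s) = - signmx R s.
Proof.
apply: signmx_ext; first by rewrite linearN /= tr_signmx.
  by move=> k; rewrite mxE signmx_diag oppr0.
by move=> b; rewrite [in RHS]mxE !signmx_lt ffunE; case: (s b); rewrite ?opprK.
Qed.

Lemma sum_upair_le (F : 'I_n -> 'I_n -> R) : (forall i j, 0 <= F i j) ->
  \sum_(b : upair n) F (val b).1 (val b).2 <= \sum_i \sum_j F i j.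
Proof.
move=> F0; rewrite pair_big /=.
rewrite -(big_map val xpredT (fun p : 'I_n * 'I_n => F p.1 p.2)) big_uniq /=; last first.
  by rewrite map_inj_uniq ?index_enum_uniq //; apply: val_inj.
rewrite [leRHS](bigID (mem (map (val : upair n -> 'I_n * 'I_n) (index_enum (upair n))))) /=.
by rewrite lerDl; apply: sumr_ge0.
Qed.

End SignMatrix.

(** * The resolvent of a random sign matrix *)

Section Ensemble.
Variables (R : realType) (n : nat) (dec : Omega n -> 'M[R]_n * 'rV[R]_n).
Hypothesis decP : forall s, is_eigdec (signmx R s) (dec s).1 (dec s).2.
Implicit Types (s : Omega n) (k : 'I_n).

Definition Kmx y s := fcalc (dec s).1 (dec s).2 (reK y).
Definition Ymx y s := fcalc (dec s).1 (dec s).2 (imY y).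

Section FixedHeight.
Variables (y : R).
Hypothesis y0 : 0 < y.

Lemma KYmx_resolvent s : is_resolvent (signmx R s) y (Kmx y s) (Ymx y s).
Proof. exact: fcalc_resolvent. Qed.

Local Notation XT := (tr_signmx R).

Lemma Kmx_neg s : Kmx y (neg s) = - Kmx y s.
Proof.
have r := resolventN (KYmx_resolvent s); have r' := KYmx_resolvent (neg s).
rewrite -signmx_neg in r.
by have [] := resolvent_uniq (XT _) r' r.
Qed.

Lemma Expect_trK : Expect (fun s => \tr (Kmx y s)) = 0.
Proof.
have := Expect_bij (fun s => \tr (Kmx y s)) (@neg_inj n).
rewrite (eq_Expect (g := fun s => - \tr (Kmx y s))) => [|s]; last by rewrite Kmx_neg linearN.
by rewrite ExpectN; lra.
Qed.

Lemma flipP (b : upair n) s :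
  [/\ is_resolvent (flip_mx (signmx R s) (val b).1 (val b).2) y
        (Kmx y (flip b s)) (Ymx y (flip b s)),
      (flip_mx (signmx R s) (val b).1 (val b).2)^T = flip_mx (signmx R s) (val b).1 (val b).2 &
      signmx R s (val b).1 (val b).2 ^+ 2 = 1].
Proof.
rewrite -signmx_flip; split; [exact: KYmx_resolvent|exact: XT|].
by apply: signmx_sqr; rewrite -val_eqE /= neq_ltn (valP b).
Qed.

(** Efron-Stein with the sum over pairs bounded sample by sample, so that row bounds of the
    resolvent can be used before taking expectations. *)
Lemma Variance_le_flip (f : Omega n -> R) (F : Omega n -> 'I_n -> 'I_n -> R) (c : R) :
  (forall s i j, 0 <= F s i j) ->
  (forall b s, (f s - f (flip b s)) ^+ 2 <= F s (val b).1 (val b).2) ->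
  (forall s, \sum_i \sum_j F s i j <= c) -> Variance f <= c / 4.
Proof.
move=> F0 fF Fc; apply: le_trans (Efron_Stein f) _.
rewrite /flip_energy -mulr_suml ler_wpM2r ?invr_ge0 //.
apply: (@le_trans _ _ (\sum_(b : upair n) Expect (fun s => F s (val b).1 (val b).2))).
  by apply: ler_sum => b _; apply: le_Expect => s; apply: fF.
rewrite -Expect_sum; apply: Expect_le_const => s; apply: le_trans (Fc s).
exact: sum_upair_le.
Qed.

Lemma Variance_trace_le (f : Omega n -> R) :
  (forall b s, `|f s - f (flip b s)| <= 4 / y ^+ 2) ->
  Variance f <= 4 * n%:R ^+ 2 / y ^+ 4.
Proof.
move=> hf.
have -> : 4 * n%:R ^+ 2 / y ^+ 4 = (n%:R ^+ 2 * (4 / y ^+ 2) ^+ 2) / 4.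
  by field; rewrite gt_eqF.
apply: (@Variance_le_flip _ (fun _ _ _ => (4 / y ^+ 2) ^+ 2)).
- by move=> *; apply: sqr_ge0.
- move=> b s; rewrite -real_normK ?num_real // ler_pXn2r ?nnegrE //.
  by rewrite divr_ge0 ?exprn_ge0 // ltW.
- move=> s; rewrite sumr_const sumr_const card_ord -mulrnA -[_ *+ (n * n)]mulr_natl.
  by rewrite natrM -expr2.
Qed.

Lemma Variance_trY : Variance (fun s => \tr (Ymx y s)) <= 4 * n%:R ^+ 2 / y ^+ 4.
Proof.
apply: Variance_trace_le => b s; have [r' XT' X1] := flipP b s.
exact: (flip_traceY y0 (XT s) X1 (KYmx_resolvent s) r' XT').
Qed.

Lemma Variance_trK : Variance (fun s => \tr (Kmx y s)) <= 4 * n%:R ^+ 2 / y ^+ 4.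
Proof.
apply: Variance_trace_le => b s; have [r' XT' X1] := flipP b s.
exact: (flip_traceK y0 (XT s) X1 (KYmx_resolvent s) r' XT').
Qed.

Lemma Expect_trK_sqr : Expect (fun s => \tr (Kmx y s) ^+ 2) <= 4 * n%:R ^+ 2 / y ^+ 4.
Proof. by have := Variance_trK; rewrite VarianceE Expect_trK expr0n /= subr0. Qed.

(** Summed over [i] and [j], the product term of [flip_Ykk_sqr_le] is the square of a row sum, of
    order [y^-4]; the linear term is [2 n] row sums times [y^-4], of order [n y^-6]. *)
Lemma Variance_Ykk k : 16 <= y ->
  Variance (fun s => Ymx y s k k) <= 32 / y ^+ 4 + 8192 * n%:R / y ^+ 6.
Proof.
move=> y16; have y2 : 0 <= y^-1 ^+ 2 by apply: sqr_ge0.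
have -> : 32 / y ^+ 4 + 8192 * n%:R / y ^+ 6 =
  (128 * (y^-1 ^+ 2 * y^-1 ^+ 2) + 16384 / y ^+ 4 * (2 * n%:R * y^-1 ^+ 2)) / 4.
  by field; rewrite gt_eqF.
have sumE (f : 'I_n -> R) (a c : R) :
    \sum_i \sum_j (a * (f i * f j) + c * (f i + f j)) =
    a * ((\sum_i f i) * (\sum_i f i)) + c * (2 * n%:R * \sum_i f i).
  rewrite mulr_suml mulr_sumr.
  have -> : 2 * n%:R * \sum_i f i = \sum_i (n%:R * f i + \sum_j f j).
    by rewrite big_split /= -mulr_sumr sumr_const card_ord -[_ *+ n]mulr_natl; ring.
  rewrite mulr_sumr -big_split; apply: eq_bigr => i _ /=.
  by rewrite big_split /= -!mulr_sumr big_split /= sumr_const card_ord -[_ *+ n]mulr_natl.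
pose rho s i := Kmx y s k i ^+ 2 + Ymx y s k i ^+ 2.
have rho0 s i : 0 <= rho s i by rewrite addr_ge0 ?sqr_ge0.
have sr s : \sum_i rho s i <= y^-1 ^+ 2.
  exact: (sum_row_resolvent_le y0 (XT s) (KYmx_resolvent s)).
have srt s : 0 <= \sum_i rho s i by apply: sumr_ge0.
have y4 : 0 <= 16384 / y ^+ 4 by rewrite divr_ge0 // exprn_ge0 // ltW.
apply: (@Variance_le_flip _ (fun s i j => 128 * (rho s i * rho s j) + 16384 / y ^+ 4 * (rho s i + rho s j))).
- by move=> s i j; apply: addr_ge0; apply: mulr_ge0 => //; [apply: mulr_ge0|apply: addr_ge0].
- move=> b s; have [r' XT' X1] := flipP b s.
  exact: (flip_Ykk_sqr_le y0 (XT s) X1 (KYmx_resolvent s) r' k y16).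
- move=> s.
  rewrite sumE.
  apply: lerD; rewrite ler_wpM2l //; first by apply: ler_pM.
  by rewrite ler_wpM2l // mulr_ge0.
Qed.

(* Discrete integration by parts: averaging over the sign [X k j] turns multiplication by it into a finite difference. *)
Lemma Expect_mul_entry (j k : 'I_n) (b : upair n) : j != k ->
  (forall s, signmx R (flip b s) = flip_mx (signmx R s) k j) ->
  Expect (fun s => signmx R s k j * Kmx y s j k) =
  Expect (fun s => Ymx y s j k * Ymx y (flip b s) j k + Ymx y s j j * Ymx y (flip b s) k k
     - (Kmx y s j k * Kmx y (flip b s) j k + Kmx y s j j * Kmx y (flip b s) k k)).
Proof.
move=> jk fb.
have -> : Expect (fun s => signmx R s k j * Kmx y s j k) =
  Expect (fun s => 2^-1 * (signmx R s k j * Kmx y s j k +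
     signmx R (flip b s) k j * Kmx y (flip b s) j k)).
  exact: (Expect_flip_half b).
apply: eq_Expect => s.
have X1 : signmx R s k j ^+ 2 = 1 by apply: signmx_sqr; rewrite eq_sym.
have r' := KYmx_resolvent (flip b s); rewrite fb in r'.
have fX : signmx R (flip b s) k j = - signmx R s k j.
  rewrite fb /flip_mx mxE [(- _ : 'M_n) _ _]mxE [(_ *: _ : 'M_n) _ _]mxE.
  rewrite [(_ + _ : 'M_n) _ _]mxE [delta_mx _ _ _ _]mxE [delta_mx _ _ _ _]mxE.
  by rewrite !eqxx eq_sym (negbTE jk) /=; ring.
have := flip_resolventK (XT s) (KYmx_resolvent s) r' j k.
move=> e; rewrite fX mulNr -mulrBr e.
move: X1; set x := signmx R s k j => X1.
set T := _ + _ - _.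
have -> : 2^-1 * (x * (- (2 * x) * T)) = - (x ^+ 2 * T) by field.
by rewrite X1 mul1r /T; ring.
Qed.

Definition rnorm s k j := `|Kmx y s k j| + `|Ymx y s k j|.

(** In [Expect_mul_entry] the flipped diagonal entries at [k] are replaced by the original ones with
    [flip_diag_le], while the off-diagonal products are bounded by squares. *)
Lemma entry_error (j k : 'I_n) : j != k ->
  `|Expect (fun s => signmx R s k j * Kmx y s j k) -
    Expect (fun s => Ymx y s j j * Ymx y s k k - Kmx y s j j * Kmx y s k k)| <=
  Expect (fun s => Kmx y s k j ^+ 2 + Ymx y s k j ^+ 2) +
    8 / y ^+ 2 * Expect (fun s => rnorm s k j).
Proof.
move=> jk; have kj : k != j by rewrite eq_sym.
have [b fb] := flip_of_pair R kj.
rewrite (Expect_mul_entry jk fb) -ExpectB; apply: le_trans (ler_norm_Expect _) _.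
(* Errors at the flipped sample have the same expectation as at [s], so the bound is split evenly
   between both samples. *)
have e1 : Expect (fun s => Kmx y s k j ^+ 2 + Ymx y s k j ^+ 2) =
  Expect (fun s => 2^-1 * ((Kmx y s k j ^+ 2 + Ymx y s k j ^+ 2) +
    (Kmx y (flip b s) k j ^+ 2 + Ymx y (flip b s) k j ^+ 2))).
  exact: (Expect_flip_half b).
have e2 : 8 / y ^+ 2 * Expect (fun s => rnorm s k j) =
  Expect (fun s => 4 / y ^+ 2 * (rnorm s k j + rnorm (flip b s) k j)).
  by rewrite (Expect_flip_half b) -ExpectZ; apply: eq_Expect => s; field; rewrite gt_eqF.
rewrite e1 e2 -ExpectD; apply: le_Expect => s.
have X1 : signmx R s k j ^+ 2 = 1 by apply: signmx_sqr.
have r := KYmx_resolvent s; have r' := KYmx_resolvent (flip b s).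
have XT' := XT (flip b s); rewrite fb in XT' r'.
have [dK dY] := flip_diag_le y0 (XT s) X1 r r' XT' erefl.
have nK := normK_le y0 (XT s) r j j; have nY := normY_le y0 (XT s) r j j.
rewrite (resolvent_symK r j k) (resolvent_symY r j k).
rewrite (resolvent_symK r' j k) (resolvent_symY r' j k).
rewrite -!/(rnorm _ _ _) in dK dY.
set N := rnorm s k j + _ in dK dY *.
have {}dK : `|Kmx y s j j * (Kmx y s k k - Kmx y (flip b s) k k)| <= 2 / y ^+ 2 * N.
  have -> : 2 / y ^+ 2 * N = y^-1 * (2 / y * N) by field; rewrite gt_eqF.
  by rewrite normrM ler_pM.
have {}dY : `|Ymx y s j j * (Ymx y s k k - Ymx y (flip b s) k k)| <= 2 / y ^+ 2 * N.
  have -> : 2 / y ^+ 2 * N = y^-1 * (2 / y * N) by field; rewrite gt_eqF.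
  by rewrite normrM ler_pM.
move: dK dY.
move: (Kmx y s k j) (Kmx y (flip b s) k j) (Ymx y s k j) (Ymx y (flip b s) k j).
move=> p p' q q'.
move: (Kmx y s j j) (Kmx y s k k) (Kmx y (flip b s) k k).
move: (Ymx y s j j) (Ymx y s k k) (Ymx y (flip b s) k k).
move=> u v v' a c c' dK dY.
have -> : q * q' + u * v' - (p * p' + a * c') - (u * v - a * c) =
  (q * q' - p * p') + (a * (c - c') - u * (v - v')) by ring.
apply: le_trans (ler_normD _ _) _; apply: lerD; last first.
  by apply: le_trans (ler_normB _ _) _; lra.
rewrite ler_norml; apply/andP; split.
  by have := sqr_ge0 (q + q'); have := sqr_ge0 (p - p'); nra.
by have := sqr_ge0 (q - q'); have := sqr_ge0 (p + p'); nra.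
Qed.

(* The self-consistent equation of the semicircle law. *)
Lemma self_consistent k (B : R) : 0 <= B -> B ^+ 2 = n%:R ->
  `|1 - y * Expect (fun s => Ymx y s k k) -
    Expect (fun s => Ymx y s k k * \tr (Ymx y s) - Kmx y s k k * \tr (Kmx y s))|
  <= 2 / y ^+ 2 + 16 * B / y ^+ 3.
Proof.
move=> B0 Bn.
have -> : 1 - y * Expect (fun s => Ymx y s k k) =
  \sum_j Expect (fun s => signmx R s k j * Kmx y s j k).
  rewrite -ExpectZ -(Expect_const n 1) -ExpectB -Expect_sum; apply: eq_Expect => s.
  have [_ _ XK _] := KYmx_resolvent s.
  have := congr1 (fun A : 'M_n => A k k) XK; rewrite !mxE eqxx mulr1n => <-.
  by rewrite addrK.
have -> : Expect (fun s => Ymx y s k k * \tr (Ymx y s) - Kmx y s k k * \tr (Kmx y s)) =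
  \sum_j Expect (fun s => Ymx y s j j * Ymx y s k k - Kmx y s j j * Kmx y s k k).
  rewrite -Expect_sum; apply: eq_Expect => s.
  by rewrite /mxtrace !mulr_sumr -sumrB; apply: eq_bigr => j _; ring.
rewrite -sumrB; apply: le_trans (ler_norm_sum _ _ _) _.
pose A j := Expect (fun s => Kmx y s k j ^+ 2 + Ymx y s k j ^+ 2).
pose N j := Expect (fun s => rnorm s k j).
have N0 j : 0 <= N j by apply: Expect_ge0 => s; rewrite addr_ge0.
apply: (@le_trans _ _ (\sum_j (A j + 8 / y ^+ 2 * N j) + y^-1 ^+ 2)).
  (* For [j = k] the sign entry is zero, so [(Y k k)^2 - (K k k)^2] is pure error, at most
     [1 / y^2]. *)
  rewrite (bigD1 k) //= [X in _ <= X + _](bigD1 k) //= [leRHS]addrC addrA.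
  apply: lerD; last by apply: ler_sum => j jk; apply: entry_error.
  rewrite (eq_Expect (g := fun=> 0)) => [|s]; last by rewrite signmx_diag mul0r.
  rewrite Expect_const sub0r normrN.
  apply: (@le_trans _ _ (y^-1 ^+ 2)); last first.
    rewrite lerDl; apply: addr_ge0.
      by apply: Expect_ge0 => s; rewrite addr_ge0 ?sqr_ge0.
    by apply: mulr_ge0 => //; rewrite divr_ge0 ?exprn_ge0 ?(ltW y0).
  apply: le_trans (ler_norm_Expect _) _; apply: Expect_le_const => s.
  have := entry_resolvent_le y0 (XT s) (KYmx_resolvent s) k k.
  rewrite -!expr2 => h; rewrite ler_norml; apply/andP.
  by have := sqr_ge0 (Kmx y s k k); have := sqr_ge0 (Ymx y s k k); split; lra.
rewrite big_split /= -mulr_sumr -!Expect_sum.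
have h1 : Expect (fun s => \sum_j (Kmx y s k j ^+ 2 + Ymx y s k j ^+ 2)) <= y^-1 ^+ 2.
  apply: Expect_le_const => s.
  exact: (sum_row_resolvent_le y0 (XT s) (KYmx_resolvent s)).
have h2 : Expect (fun s => \sum_j rnorm s k j) <= 2 * B / y.
  apply: Expect_le_const => s.
  exact: (sum_row_norm_le y0 (XT s) (KYmx_resolvent s) k B0 Bn).
have -> : 2 / y ^+ 2 + 16 * B / y ^+ 3 = y^-1 ^+ 2 + 8 / y ^+ 2 * (2 * B / y) + y^-1 ^+ 2.
  by field; rewrite gt_eqF.
by rewrite lerD2r lerD // ler_wpM2l // divr_ge0 // exprn_ge0 // ltW.
Qed.

End FixedHeight.
End Ensemble.

(** * The mean resolvent and the semicircle law *)

Section MeanResolvent.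
Variables (R : realType) (n : nat) (dec : Omega n -> 'M[R]_n * 'rV[R]_n).
Hypothesis decP : forall s, is_eigdec (signmx R s) (dec s).1 (dec s).2.
Variables (q : R).
Hypothesis q1 : 1 <= q.
Hypothesis qn : q ^+ 4 = n%:R.

(** For [y > 0], [i theta y / n] is the mean Stieltjes transform of the spectrum at [i y], because
    [tr K] has mean zero. *)
Definition theta (y : R) := Expect (fun s => \tr (Ymx dec y s)).

Let q0 : 0 < q. Proof. exact: lt_le_trans q1. Qed.

Section Height.
Variable y : R.
Hypothesis yq : 8 * q <= y.

Let y0 : 0 < y. Proof. by apply: lt_le_trans yq; rewrite mulr_gt0. Qed.

Lemma theta_ge0 : 0 <= theta y.
Proof.
apply: Expect_ge0 => s; apply: sumr_ge0 => k _.
exact: (resolvent_Y_ge0 y0 (tr_signmx R s) (KYmx_resolvent decP y0 s)).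
Qed.

Definition sc_error := 2 / y ^+ 2 + 16 * q ^+ 2 / y ^+ 3.

Let sc k : `|1 - y * Expect (fun s => Ymx dec y s k k) -
    Expect (fun s => Ymx dec y s k k * \tr (Ymx dec y s) - Kmx dec y s k k * \tr (Kmx dec y s))|
  <= sc_error.
Proof.
apply: self_consistent => //; first exact: sqr_ge0.
by rewrite -qn; ring.
Qed.

(** Sum [self_consistent] over [k]; replacing the mean of [(tr Y)^2] by [theta y ^+ 2] costs the
    variance of [tr Y], and the term in [K] is the variance of [tr K]. *)
Lemma theta_quadratic :
  `|theta y ^+ 2 + y * theta y - n%:R| <= n%:R * (sc_error + 4 * q ^+ 4 / y ^+ 4).
Proof.
have vY := Variance_trY decP y0; have vK := Expect_trK_sqr decP y0.
have vY0 := Variance_ge0 (fun s => \tr (Ymx dec y s)).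
rewrite VarianceE -/(theta y) in vY vY0.
have vK0 : 0 <= Expect (fun s => \tr (Kmx dec y s) ^+ 2).
  by apply: Expect_ge0 => s; apply: sqr_ge0.
set EY := Expect (fun s => \tr (Ymx dec y s) ^+ 2) in vY vY0.
set EK := Expect _ in vK vK0.
have e : \sum_k (1 - y * Expect (fun s => Ymx dec y s k k) -
    Expect (fun s => Ymx dec y s k k * \tr (Ymx dec y s) - Kmx dec y s k k * \tr (Kmx dec y s)))
   = n%:R - y * theta y - (EY - EK).
  rewrite 2!sumrB sumr_const card_ord -mulr_sumr -!Expect_sum -ExpectB; congr (_ - _ - _).
  apply: eq_Expect => s; rewrite sumrB -!mulr_suml; by rewrite !expr2.
have h : `|n%:R - y * theta y - (EY - EK)| <= n%:R * sc_error.
  rewrite -e; apply: le_trans (ler_norm_sum _ _ _) _.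
  apply: le_trans (ler_sum _ (fun k _ => sc k)) _.
  by rewrite sumr_const card_ord -[_ *+ n]mulr_natl.
have e4 : 4 * n%:R ^+ 2 / y ^+ 4 = n%:R * (4 * q ^+ 4 / y ^+ 4).
  by rewrite qn; field; rewrite gt_eqF.
rewrite e4 in vY vK; rewrite mulrDr.
move: h; rewrite !ler_norml => /andP[h1 h2]; apply/andP; split; lra.
Qed.

Let yV_le : y^-1 <= q^-1 / 8.
Proof. by rewrite -invfM lef_pV2 ?posrE 1?mulrC // mulr_gt0. Qed.

Let qV_le1 : q^-1 <= 1. Proof. by rewrite invf_le1. Qed.
Let yV0 : 0 < y^-1. Proof. by rewrite invr_gt0. Qed.
Let qy_le : q / y <= 8^-1.
Proof. by rewrite ler_pdivrMr //; have := yq; lra. Qed.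
Let qy0 : 0 < q / y. Proof. by rewrite divr_gt0. Qed.
Let yV8 : y^-1 <= 8^-1. Proof. by have := yV_le; have := qV_le1; lra. Qed.

Lemma sc_errorE : sc_error = 2 * y^-1 ^+ 2 + 16 * (q / y) ^+ 2 * y^-1.
Proof. by rewrite /sc_error; field; rewrite gt_eqF. Qed.

Lemma quadratic_error_le : sc_error + 4 * q ^+ 4 / y ^+ 4 <= 2^-1.
Proof.
rewrite sc_errorE.
have -> : 4 * q ^+ 4 / y ^+ 4 = 4 * ((q / y) ^+ 2) ^+ 2 by field; rewrite gt_eqF.
have e64 : 64^-1 = 8^-1 ^+ 2 :> R by field.
have a : (q / y) ^+ 2 <= 64^-1 by rewrite e64 ler_pXn2r ?nnegrE ?invr_ge0 ?(ltW qy0).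
have b : y^-1 ^+ 2 <= 64^-1 by rewrite e64 ler_pXn2r ?nnegrE ?invr_ge0 ?(ltW y0).
have a0 : 0 <= (q / y) ^+ 2 by apply: sqr_ge0.
have c : ((q / y) ^+ 2) ^+ 2 <= 64^-1 * 64^-1 by rewrite expr2; apply: ler_pM.
have d : (q / y) ^+ 2 * y^-1 <= 64^-1 * 8^-1 by apply: ler_pM => //; apply: ltW.
lra.
Qed.

Lemma theta_quadratic_bounds :
  q ^+ 4 / 2 <= theta y ^+ 2 + y * theta y <= 3 / 2 * q ^+ 4.
Proof.
have h := theta_quadratic; rewrite -qn in h.
have h2 : q ^+ 4 * (sc_error + 4 * q ^+ 4 / y ^+ 4) <= q ^+ 4 * 2^-1.
  by rewrite ler_wpM2l ?quadratic_error_le // exprn_ge0 // ltW.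
move: (le_trans h h2); rewrite ler_norml => /andP[? ?]; apply/andP; split; lra.
Qed.

Lemma theta_le : theta y <= 2 * q ^+ 2.
Proof.
have /andP[_ h] := theta_quadratic_bounds; have t0 := theta_ge0.
rewrite -(@ler_pXn2r _ 2) ?nnegrE //; last by rewrite mulr_ge0 ?sqr_ge0.
have := mulr_ge0 (ltW y0) t0; have : 0 <= q ^+ 4 by rewrite exprn_ge0 ?ltW.
lra.
Qed.

Lemma thetaDy_ge : q ^+ 2 / 2 <= theta y + y.
Proof.
have /andP[h _] := theta_quadratic_bounds; have t0 := theta_ge0.
have ty : 0 <= theta y + y by rewrite addr_ge0 // ltW.
rewrite -(@ler_pXn2r _ 2) ?nnegrE //; last by rewrite divr_ge0 ?sqr_ge0.
have := mulr_ge0 (ltW y0) t0; have : 0 <= q ^+ 4 by rewrite exprn_ge0 ?ltW.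
have := sqr_ge0 y.
lra.
Qed.

(** If [theta y < q^2 / 2], then [theta y + y <= q^2], and [theta y (theta y + y)] would be below
    [q^4 / 2]. *)
Lemma theta_ge : y <= q ^+ 2 / 2 -> q ^+ 2 / 2 <= theta y.
Proof.
move=> yh; have /andP[h _] := theta_quadratic_bounds; have t0 := theta_ge0.
rewrite leNgt; apply/negP => lt.
have Q0 : 0 < q ^+ 2 by rewrite exprn_gt0.
have e4 : q ^+ 4 = q ^+ 2 * q ^+ 2 by ring.
rewrite e4 in h.
have : theta y * (theta y + y) <= theta y * q ^+ 2 by rewrite ler_wpM2l //; lra.
have : theta y * q ^+ 2 < q ^+ 2 / 2 * q ^+ 2 by rewrite ltr_pM2r.
lra.
Qed.

Lemma Expect_mul_centered_le (f g : Omega n -> R) (c b : R) : 0 <= b -> 0 <= c ->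
  (forall s, `|f s| <= c) -> Expect (fun s => g s ^+ 2) <= b ^+ 2 ->
  `|Expect (fun s => f s * g s)| <= c * b.
Proof.
move=> b0 c0 fc gb; apply: le_trans (ler_norm_Expect _) _.
apply: (@le_trans _ _ (c * Expect (fun s => `|g s|))).
  by rewrite -ExpectZ; apply: le_Expect => s; rewrite normrM ler_wpM2r.
by rewrite ler_wpM2l // le_Expect_sqrt.
Qed.

(** Replace [tr Y] by its mean in [self_consistent]. As the entries are at most [1 / y], this costs
    [1 / y] times the standard deviation of the trace, and the same holds for the term in [K]. *)
Lemma Expect_Ykk_eq k :
  `|Expect (fun s => Ymx dec y s k k) * (theta y + y) - 1| <= sc_error + 4 * q ^+ 4 / y ^+ 3.
Proof.
have XT := @tr_signmx R n; have res := KYmx_resolvent decP y0.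
have vb : 4 * n%:R ^+ 2 / y ^+ 4 = (2 * q ^+ 4 / y ^+ 2) ^+ 2.
  by rewrite qn; field; rewrite gt_eqF.
have b0 : 0 <= 2 * q ^+ 4 / y ^+ 2.
  by rewrite !mulr_ge0 ?invr_ge0 ?exprn_ge0 // ltW.
have cY : `|Expect (fun s => Ymx dec y s k k * (\tr (Ymx dec y s) - theta y))|
    <= y^-1 * (2 * q ^+ 4 / y ^+ 2).
  apply: (Expect_mul_centered_le (f := fun s => Ymx dec y s k k)) => //; first exact: ltW.
    by move=> s; exact: (normY_le y0 (XT s) (res s)).
  by rewrite -vb; exact: (Variance_trY decP y0).
have cK : `|Expect (fun s => Kmx dec y s k k * \tr (Kmx dec y s))|
    <= y^-1 * (2 * q ^+ 4 / y ^+ 2).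
  apply: (Expect_mul_centered_le (f := fun s => Kmx dec y s k k)) => //; first exact: ltW.
    by move=> s; exact: (normK_le y0 (XT s) (res s)).
  by rewrite -vb; exact: (Expect_trK_sqr decP y0).
have := sc k; rewrite ExpectB => h.
have e : Expect (fun s => Ymx dec y s k k * \tr (Ymx dec y s)) =
  theta y * Expect (fun s => Ymx dec y s k k) +
  Expect (fun s => Ymx dec y s k k * (\tr (Ymx dec y s) - theta y)).
  by rewrite -ExpectZ -ExpectD; apply: eq_Expect => s; ring.
rewrite {}e in h.
have e : 4 * q ^+ 4 / y ^+ 3 = 2 * (y^-1 * (2 * q ^+ 4 / y ^+ 2)) by field; rewrite gt_eqF.
rewrite {}e; move: h cY cK; rewrite !ler_norml => /andP[? ?] /andP[? ?] /andP[? ?].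
by apply/andP; split; lra.
Qed.

(** Here [t] solves the quadratic equation exactly and [t / n = 1 / (t + y)] is the semicircle
    value. The error decays like [(q / y)^2], which is summable over the heights of the Riemann
    sum. *)
Lemma Expect_Ykk_approx k (t : R) : 0 < t -> t ^+ 2 + y * t = n%:R ->
  `|y * Expect (fun s => Ymx dec y s k k) - y * t / n%:R| <= 17 * (q / y) ^+ 2.
Proof.
move=> t0 tE; have n0 : 0 < n%:R :> R by rewrite -qn exprn_gt0.
have th0 := theta_ge0; have ty := thetaDy_ge.
have Ty0 : 0 < theta y + y by rewrite ltr_wpDl.
have h1 := Expect_Ykk_eq k; have h2 := theta_quadratic.
set a := Expect _ in h1 *; set T := theta y in h1 h2 th0 ty Ty0.
set E := sc_error in h1 h2.
have hT : t / n%:R * `|T - t| <= E + 4 * q ^+ 4 / y ^+ 4.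
  have e : T ^+ 2 + y * T - n%:R = (T - t) * (T + t + y) by rewrite -tE; ring.
  rewrite e normrM -ler_pdivrMl // in h2.
  apply: le_trans h2; rewrite mulrAC mulrC ler_wpM2l ?invr_ge0 ?(ltW n0) //.
  rewrite mulrC ler_wpM2l // ger0_norm; first by have := ltW y0; lra.
  by rewrite !addr_ge0 // ltW.
have key : `|(a - t / n%:R) * (T + y)| <= 2 * E + 4 * q ^+ 4 / y ^+ 3 + 4 * q ^+ 4 / y ^+ 4.
  have -> : (a - t / n%:R) * (T + y) = (a * (T + y) - 1) - t / n%:R * (T - t).
    by rewrite -tE; field; rewrite tE gt_eqF.
  apply: le_trans (ler_normB _ _) _; rewrite normrM ger0_norm; last by rewrite divr_ge0 // ltW.
  by lra.
have -> : y * a - y * t / n%:R = (a - t / n%:R) * (T + y) * (y / (T + y)).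
  by field; rewrite !gt_eqF.
(* Two bounds on this factor are used: [1] for the smaller errors, and [2 y / q^2] to turn
   [q^4 / y^3] into [(q / y)^2]. *)
have r0 : 0 <= y / (T + y) by rewrite divr_ge0 // ltW.
have r1 : y / (T + y) <= 1 by rewrite ler_pdivrMr // mul1r lerDr.
have r2 : y / (T + y) <= 2 * y / q ^+ 2.
  rewrite ler_pdivrMr //.
  have -> : 2 * y / q ^+ 2 * (T + y) = y * (2 * (T + y) / q ^+ 2) by ring.
  by rewrite ler_peMr ?(ltW y0) // ler_pdivlMr ?exprn_gt0 //; lra.
rewrite normrM [`|y / _|]ger0_norm //.
apply: le_trans (ler_wpM2r r0 key) _.
have E0 : 0 <= E by rewrite /E sc_errorE !addr_ge0 ?mulr_ge0 ?exprn_ge0 // ltW.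
have F0 : 0 <= 4 * q ^+ 4 / y ^+ 4 by rewrite !mulr_ge0 ?invr_ge0 ?exprn_ge0 // ltW.
have G0 : 0 <= 4 * q ^+ 4 / y ^+ 3 by rewrite !mulr_ge0 ?invr_ge0 ?exprn_ge0 // ltW.
have s1 : (2 * E + 4 * q ^+ 4 / y ^+ 4) * (y / (T + y)) <= 2 * E + 4 * q ^+ 4 / y ^+ 4.
  by rewrite ler_piMr // addr_ge0 // mulr_ge0.
have s2 : 4 * q ^+ 4 / y ^+ 3 * (y / (T + y)) <= 8 * (q / y) ^+ 2.
  apply: le_trans (ler_wpM2l G0 r2) _; rewrite le_eqVlt; apply/orP; left; apply/eqP.
  by field; rewrite !gt_eqF.
have s3 : 2 * E + 4 * q ^+ 4 / y ^+ 4 <= 9 * (q / y) ^+ 2.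
  rewrite /E sc_errorE.
  have -> : 4 * q ^+ 4 / y ^+ 4 = 4 * ((q / y) ^+ 2) ^+ 2 by field; rewrite gt_eqF.
  have P0 : 0 <= (q / y) ^+ 2 by apply: sqr_ge0.
  have : (q / y) ^+ 2 <= 8^-1 ^+ 2 by rewrite ler_pXn2r ?nnegrE ?invr_ge0 ?(ltW qy0).
  have : y^-1 ^+ 2 <= (q / y) ^+ 2.
    by rewrite ler_pXn2r ?nnegrE ?(ltW qy0) ?(ltW yV0) // ler_peMl // ltW.
  have := ler_wpM2l P0 yV8; set z := y^-1; set P := (q / y) ^+ 2 in P0 * => h1' h2' h3'.
  have := ler_wpM2l P0 h3'; lra.
lra.
Qed.

End Height.
End MeanResolvent.

(** * Riemann sums *)

Section RiemannSums.
Variable R : realType.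

(** [F] plays the antiderivative of a decreasing [g] on a grid of step [h]. The sums at right and
    left endpoints enclose its increment and differ by [h (g 0 - g M)]. *)
Lemma riemann_sum_le (F g : nat -> R) (h : R) :
  (forall i, h * g i.+1 <= F i.+1 - F i <= h * g i) -> forall M,
  \sum_(i < M) h * g i.+1 <= F M - F 0%N <= \sum_(i < M) h * g i.+1 + h * (g 0%N - g M).
Proof.
move=> Fg; elim=> [|M /andP[IH1 IH2]].
  by rewrite big_ord0 !subrr mulr0 addr0 lexx.
rewrite !big_ord_recr /=; have /andP[h1 h2] := Fg M.
apply/andP; split; first by lra.
rewrite mulrBr; move: IH2; rewrite mulrBr; lra.
Qed.

Lemma atan_diff_bounds (u v : R) : 0 <= u -> u <= v ->
  (v - u) * (1 + v ^+ 2)^-1 <= atan v - atan u <= (v - u) * (1 + u ^+ 2)^-1.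
Proof.
move=> u0 uv.
have [c] := @MVT_segment R atan (fun x => (1 + x ^+ 2)^-1) u v uv
  (fun x _ => is_derive1_atan x) (continuous_subspaceT (@continuous_atan R)).
rewrite in_itv /= => /andP[uc cv] ->.
have p (x : R) : 0 < 1 + x ^+ 2 by rewrite ltr_wpDr ?sqr_ge0.
rewrite ![(v - u) * _]mulrC !ler_wpM2r ?subr_ge0 // lef_pV2 ?posrE // lerD2l.
  by rewrite ler_pXn2r ?nnegrE // (le_trans u0).
by rewrite ler_pXn2r ?nnegrE // ?(le_trans u0) // (le_trans u0 uc).
Qed.

(** [pi / 2 - atan z = atan (1 / z) <= 1 / z]. *)
Lemma atan_ge_pihalf (z : R) : 0 < z -> pi / 2 - z^-1 <= atan z.
Proof.
move=> z0; set a := atan z.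
have a0 : 0 < a by rewrite -(@atan0 R) lt_atan.
have a2 : a < pi / 2 := atan_ltpi2 z.
have w0 : 0 < pi / 2 - a by rewrite subr_gt0.
have sw : sin (pi / 2 - a) = cos a by rewrite -opprB sinN sinBpihalf opprK.
have cw : cos (pi / 2 - a) = sin a by rewrite -opprB cosN cosBpihalf.
have tw : tan (pi / 2 - a) = z^-1 by rewrite /tan sw cw -[in RHS](atanK z) /tan invf_div.
have wE : pi / 2 - a = atan z^-1.
  rewrite -tw tanK // in_itv /=; apply/andP; split; lra.
have zi0 : 0 <= z^-1 by rewrite invr_ge0 ltW.
have /andP[_] := atan_diff_bounds (lexx 0) zi0.
rewrite atan0 !subr0 expr0n /= addr0 invr1 mulr1 -wE; lra.
Qed.

(** Riemann sum, truncated at [M h], for the integral of [x^2 / (x^2 + y^2)] over [y > 0], which is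
    [pi / 2 * |x|]. Right endpoints keep all heights at least [h]. *)
Definition abs_sum (h : R) M (x : R) := \sum_(i < M) h * (x ^+ 2 / (x ^+ 2 + (i.+1%:R * h) ^+ 2)).

(** After scaling by [|x|] the antiderivative is [atan]. The error [h] is the discretisation, and
    [x^2 / (M h)] is the truncated tail. *)
Lemma abs_sum_approx (h : R) M (x : R) : 0 < h -> (0 < M)%N ->
  `|pi / 2 * `|x| - abs_sum h M x| <= h + x ^+ 2 / (M%:R * h).
Proof.
move=> h0 M0; rewrite /abs_sum -!(real_normK (num_real x)).
have [->|xn0] := eqVneq x 0.
  rewrite normr0 mulr0 sub0r normrN expr0n /= mul0r addr0.
  rewrite big1 ?normr0 ?ltW // => i _; by rewrite mul0r mulr0.
have a0 : 0 < `|x| by rewrite normr_gt0.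
move: (`|x|) a0 => a a0 {x xn0}.
have d0 : 0 < h / a by rewrite divr_gt0.
pose F i := atan (i%:R * (h / a)).
pose g (i : nat) := (1 + (i%:R * (h / a)) ^+ 2)^-1.
have p (x : R) : 0 < 1 + x ^+ 2 by rewrite ltr_wpDr ?sqr_ge0.
have Fg i : h / a * g i.+1 <= F i.+1 - F i <= h / a * g i.
  have u0 : 0 <= i%:R * (h / a) by rewrite mulr_ge0 ?ler0n ?(ltW d0).
  have uv : i%:R * (h / a) <= i.+1%:R * (h / a) by rewrite ler_wpM2r ?ler_nat // ltW.
  have := atan_diff_bounds u0 uv.
  by have -> : i.+1%:R * (h / a) - i%:R * (h / a) = h / a by rewrite -natr1; ring.
have /andP[] := riemann_sum_le Fg M.
have -> : \sum_(i < M) h / a * g i.+1 = (\sum_(i < M) h * (a ^+ 2 / (a ^+ 2 + (i.+1%:R * h) ^+ 2))) / a.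
  rewrite mulr_suml; apply: eq_bigr => i _; rewrite /g; field.
  by rewrite (gt_eqF a0) /= gt_eqF // ltr_pwDl ?exprn_gt0 ?sqr_ge0.
set S := \sum_(i < M) _.
rewrite /F mul0r atan0 subr0 => h1 h2.
have gM : 0 <= g M by rewrite invr_ge0 ltW.
have g0 : g 0%N = 1 by rewrite /g mul0r expr0n /= addr0 invr1.
have z0 : 0 < M%:R * (h / a) by rewrite mulr_gt0 ?ltr0n.
have h3 := atan_ge_pihalf z0; have h4 := atan_ltpi2 (M%:R * (h / a)).
set T := atan _ in h1 h2 h3 h4.
have l1 : S <= pi / 2 * a.
  by rewrite -ler_pdivrMr //; lra.
have l2 : pi / 2 - (M%:R * (h / a))^-1 <= S / a + h / a.
  rewrite g0 mulrBr mulr1 in h2.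
  by have := mulr_ge0 (ltW d0) gM; lra.
have l3 : pi / 2 * a <= S + h + a ^+ 2 / (M%:R * h).
  have e : S + h + a ^+ 2 / (M%:R * h) = (S / a + h / a + (M%:R * (h / a))^-1) * a.
    by field; rewrite !gt_eqF // ltr0n.
  by rewrite e ler_wpM2r ?(ltW a0) //; lra.
rewrite ger0_norm ?subr_ge0 //; lra.
Qed.

(** The positive root of [t^2 + y t = N] for [N > 0]: up to the factor [N], the imaginary part at
    [i y] of the Stieltjes transform of the semicircle law of variance [N]. *)
Definition theta0 (N y : R) := (Num.sqrt (y ^+ 2 + 4 * N) - y) / 2.

Lemma theta0P (N y : R) : 0 < N -> 0 <= y ->
  0 < theta0 N y /\ theta0 N y ^+ 2 + y * theta0 N y = N.
Proof.
move=> N0 y0; have p : 0 <= y ^+ 2 + 4 * N by rewrite addr_ge0 ?sqr_ge0 ?mulr_ge0 ?(ltW N0).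
split; last first.
  have := sqr_sqrtr p; rewrite /theta0; set w := Num.sqrt _ => e.
  have -> : ((w - y) / 2) ^+ 2 + y * ((w - y) / 2) = (w ^+ 2 - y ^+ 2) / 4 by field.
  by rewrite e; field.
rewrite /theta0 divr_gt0 // subr_gt0 -[ltLHS](ger0_norm y0) -sqrtr_sqr ltr_sqrt; last first.
  by rewrite ltr_wpDl ?sqr_ge0 ?mulr_gt0.
by rewrite ltrDl mulr_gt0.
Qed.

(* With [t (t + y) = N], the function [- t - t^3 / (3 N)] is an antiderivative of [t^2 / N] in [y]. *)
Lemma theta_antiderivative (N y z t u : R) : 0 < N -> 0 <= y -> y <= z -> 0 < t -> 0 < u ->
  t ^+ 2 + y * t = N -> u ^+ 2 + z * u = N ->
  (z - y) * (u ^+ 2 / N) <= (- (u + u ^+ 3 / (3 * N))) - (- (t + t ^+ 3 / (3 * N)))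
    <= (z - y) * (t ^+ 2 / N).
Proof.
move=> N0 y0 yz t0 u0 tE uE.
have ut : u <= t.
  rewrite leNgt; apply/negP => tu.
  have : t * t < u * u by apply: ltr_pM => //; apply: ltW.
  have : y * t <= z * u by apply: ler_pM => //; apply: ltW.
  by rewrite -!expr2; lra.
have yE : y = N / t - t by rewrite -tE; field; rewrite gt_eqF.
have zE : z = N / u - u by rewrite -uE; field; rewrite gt_eqF.
have -> : z - y = (t - u) * (1 + N / (t * u)) by rewrite yE zE; field; rewrite !gt_eqF.
have -> : - (u + u ^+ 3 / (3 * N)) - - (t + t ^+ 3 / (3 * N)) =
  (t - u) * (1 + (t ^+ 2 + t * u + u ^+ 2) / (3 * N)) by field; rewrite !gt_eqF.
have -> : (t - u) * (1 + N / (t * u)) * (u ^+ 2 / N) = (t - u) * (u ^+ 2 / N + u / t).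
  by field; rewrite !gt_eqF.
have -> : (t - u) * (1 + N / (t * u)) * (t ^+ 2 / N) = (t - u) * (t ^+ 2 / N + t / u).
  by field; rewrite !gt_eqF.
have r1 : u / t <= 1 by rewrite ler_pdivrMr // mul1r.
have r2 : 1 <= t / u by rewrite ler_pdivlMr // mul1r.
have e : (t ^+ 2 + t * u + u ^+ 2) / (3 * N) = (t ^+ 2 / N + t * u / N + u ^+ 2 / N) / 3.
  by field; rewrite gt_eqF.
have q1 : u ^+ 2 / N <= t * u / N by rewrite ler_pM2r ?invr_gt0 // expr2 ler_wpM2r // ltW.
have q2 : t * u / N <= t ^+ 2 / N by rewrite ler_pM2r ?invr_gt0 // expr2 ler_wpM2l // ltW.
by apply/andP; split; rewrite ler_wpM2l ?subr_ge0 //; lra.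
Qed.

(** The antiderivative starts at [- 4/3 q^2], since [t = q^2] at height [0]. At height [M h] it is
    [O(q)], because there [t <= N / (M h) <= q / 8]; the discretisation adds at most [h = 8 q]. *)
Lemma semicircle_sum (q h : R) M : 0 < q -> h = 8 * q -> (0 < M)%N -> q ^+ 2 <= M%:R ->
  `|\sum_(i < M) h * (theta0 (q ^+ 4) (i.+1%:R * h) ^+ 2 / q ^+ 4) - 4 / 3 * q ^+ 2| <= 9 * q.
Proof.
move=> q0 hE M0 qM.
have h0 : 0 < h by rewrite hE mulr_gt0.
have N0 : 0 < q ^+ 4 by rewrite exprn_gt0.
set N := q ^+ 4 in N0 *.
pose t (i : nat) := theta0 N (i%:R * h).
pose F i := - (t i + t i ^+ 3 / (3 * N)).
have tP i : 0 < t i /\ t i ^+ 2 + i%:R * h * t i = N.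
  by apply: theta0P => //; rewrite mulr_ge0 // ltW.
have Fg i : h * (t i.+1 ^+ 2 / N) <= F i.+1 - F i <= h * (t i ^+ 2 / N).
  have [t1 t2] := tP i; have [u1 u2] := tP i.+1.
  have e : i.+1%:R * h - i%:R * h = h by rewrite -natr1; ring.
  rewrite -[X in X * (t i.+1 ^+ 2 / N)]e -[X in X * (t i ^+ 2 / N)]e.
  apply: theta_antiderivative => //; first by rewrite mulr_ge0 // ltW.
  by rewrite ler_wpM2r ?ler_nat // ltW.
have /andP[] := riemann_sum_le (g := fun i => t i ^+ 2 / N) Fg M.
set S := \sum_(i < M) _.
have t0 : t 0%N = q ^+ 2.
  have [p e] := tP 0%N; rewrite !mul0r addr0 in e.
  have : (t 0%N) ^+ 2 == (q ^+ 2) ^+ 2 by rewrite e /N -exprM.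
  by rewrite eqrXn2 ?sqr_ge0 ?(ltW p) // => /eqP.
have F0 : F 0%N = - (4 / 3 * q ^+ 2).
  by rewrite /F t0 /N; field; rewrite gt_eqF.
have [tM tME] := tP M.
have tq : t M <= q / 8.
  have Mh : 0 < M%:R * h by rewrite mulr_gt0 ?ltr0n.
  apply: (@le_trans _ _ (N / (M%:R * h))).
    by rewrite ler_pdivlMr // mulrC -tME lerDr sqr_ge0.
  rewrite ler_pdivrMr // hE.
  have -> : q / 8 * (M%:R * (8 * q)) = q ^+ 2 * M%:R by field.
  have -> : N = q ^+ 2 * q ^+ 2 by rewrite /N; ring.
  by rewrite ler_wpM2l ?sqr_ge0.
have tM2 : t M ^+ 2 <= N by rewrite -tME lerDl mulr_ge0 ?(ltW tM) // mulr_ge0 // ltW.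
have tM3 : t M ^+ 3 / (3 * N) <= t M / 3.
  have -> : t M ^+ 3 / (3 * N) = t M / 3 * (t M ^+ 2 / N) by field; rewrite gt_eqF.
  have r : t M ^+ 2 / N <= 1 by rewrite ler_pdivrMr ?mul1r.
  by rewrite ler_piMr // divr_ge0 ?(ltW tM).
have tM30 : 0 <= t M ^+ 3 / (3 * N)
  by apply: divr_ge0; [apply: exprn_ge0; apply: ltW|apply: mulr_ge0 => //; apply: ltW].
have g0 : t 0%N ^+ 2 / N = 1 by rewrite t0 /N -exprM divff // gt_eqF.
have gM : 0 <= t M ^+ 2 / N by rewrite divr_ge0 ?sqr_ge0 ?(ltW N0).
rewrite F0 g0 /F => h1 h2.
have h3 : h * (1 - t M ^+ 2 / N) <= h by rewrite ler_piMr ?(ltW h0) //; lra.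
change (`|S - 4 / 3 * q ^+ 2| <= 9 * q).
by rewrite ler_norml; apply/andP; split; move: h1 h2 h3 tM3 tM30 tq hE; lra.
Qed.

Lemma sum_inv_sqr_le M : \sum_(i < M) (i.+1%:R ^+ 2)^-1 <= 2 :> R.
Proof.
suff h : \sum_(i < M) (i.+1%:R ^+ 2)^-1 <= 2 - M%:R^-1 :> R.
  by apply: le_trans h _; rewrite gerBl invr_ge0.
(* The inverse of [0] is [0], so the telescoping difference only starts at [M = 1]; the first two
   cases are separate. *)
elim: M => [|M IH]; first by rewrite big_ord0 invr0 subr0.
rewrite big_ord_recr /=; case: M IH => [|M] IH.
  by rewrite big_ord0 expr1n invr1; lra.
have M0 : 0 < M.+1%:R :> R by rewrite ltr0n.
have M1 : M.+2%:R = M.+1%:R + 1 :> R by rewrite natr1.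
have : (M.+2%:R ^+ 2)^-1 <= M.+1%:R^-1 - M.+2%:R^-1 :> R.
  rewrite M1; move: (M.+1%:R : R) M0 => m M0.
  have -> : m^-1 - (m + 1)^-1 = (m * (m + 1))^-1 by field; rewrite !gt_eqF // addr_gt0.
  have m1 : 0 < m + 1 by rewrite addr_gt0.
  rewrite lef_pV2 ?posrE; [|by rewrite exprn_gt0|by rewrite mulr_gt0].
  by rewrite expr2 ler_wpM2r ?(ltW m1) // lerDl.
move=> h; apply: le_trans (lerD IH h) _; by rewrite addrA subrK.
Qed.

End RiemannSums.

(** * Median eigenvalues *)

Section PositivePartTrace.
Variables (R : realType) (n : nat).
Implicit Types (X U : 'M[R]_n) (lam : 'rV[R]_n).

Definition trpos lam (a : R) := \sum_i Num.max (lam 0 i - a) 0.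

Definition above (a : R) : R -> R := fun x => if a < x then 1 else 0.

Lemma quad_idempotent_ge0 U (V : 'M[R]_n) lam (g : R -> R) i : U^T *m U = 1%:M ->
  (forall x, g x * g x = g x) -> 0 <= (V^T *m fcalc U lam g *m V) i i.
Proof.
move=> UU gg; have -> : fcalc U lam g = (fcalc U lam g)^T *m fcalc U lam g.
  by rewrite tr_fcalc fcalcM //; apply: eq_fcalc => x; rewrite gg.
rewrite mulmxA -trmx_mul -mulmxA mxE; apply: sumr_ge0 => j _.
by rewrite mxE -expr2 sqr_ge0.
Qed.

(* [tr (X - a)_+] is the maximum of [tr (P (X - a))] over [0 <= P <= 1], attained at the spectral projector: it is convex, with that projector as subgradient. *)
Lemma trpos_subgradient X X' U lam U' lam' (a : R) :
  U^T *m U = 1%:M -> X = fcalc U lam id ->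
  U'^T *m U' = 1%:M -> X' = fcalc U' lam' id ->
  trpos lam a - trpos lam' a <= \tr (fcalc U lam (above a) *m (X - X')).
Proof.
move=> UU XE UU' XE'; set P := fcalc U lam (above a).
have e1 : trpos lam a = \tr (P *m X) - a * \tr P.
  rewrite XE fcalcM // !mxtrace_fcalc // mulr_sumr -sumrB; apply: eq_bigr => i _.
  by rewrite /above; case: ltP => h; case: leP; lra.
(* In the eigenbasis of [X'] the diagonal entries [p i] of the projector lie in [[0, 1]], so each
   term is at most the positive part. *)
have e2 : \tr (P *m X') - a * \tr P <= trpos lam' a.
  pose p i := (U'^T *m P *m U') i i.
  have pE (g : R -> R) : \tr (P *m fcalc U' lam' g) = \sum_i p i * g (lam' 0 i).
    rewrite /p; move: (P) => Q; rewrite [fcalc U' lam' g]/fcalc !mulmxA mxtrace_mulC !mulmxA; apply: eq_bigr => i _.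
    by rewrite mul_mx_diag mxE [map_mx _ _ _ _]mxE.
  have p0 i : 0 <= p i.
    by apply: quad_idempotent_ge0 => // x; rewrite /above; case: ifP; rewrite ?mul1r ?mul0r.
  have p1 i : p i <= 1.
    rewrite -subr_ge0.
    have -> : 1 - p i = (U'^T *m fcalc U lam (fun x => 1 - above a x) *m U') i i.
      have -> : fcalc U lam (fun x => 1 - above a x) = 1%:M - P.
        rewrite -(fcalc1 lam UU) /P -scaleN1r fcalcZ fcalcD.
        by apply: eq_fcalc => x; rewrite mulN1r.
      by rewrite mulmxBr mulmxBl mulmx1 UU' [RHS]mxE [in RHS]mxE mxE eqxx.
    apply: quad_idempotent_ge0 => // x; rewrite /above.
    by case: ifP; rewrite ?subrr ?subr0 ?mul1r ?mul0r.
  have -> : \tr P = \sum_i p i * 1.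
    by rewrite -(pE (fun=> 1)) fcalc1 // mulmx1.
  rewrite XE' pE mulr_sumr -sumrB; apply: ler_sum => i _.
  have := p0 i; have := p1 i; move: (p i) (lam' 0 i) => u l u1 u0.
  by have [h|h] := leP (l - a) 0; clear -u0 u1 h; nra.
by rewrite mulmxBr linearB /=; lra.
Qed.

Lemma trpos_uniq X U lam U' lam' (a : R) :
  U^T *m U = 1%:M -> X = fcalc U lam id ->
  U'^T *m U' = 1%:M -> X = fcalc U' lam' id -> trpos lam a = trpos lam' a.
Proof.
move=> UU XE UU' XE'; apply/eqP; rewrite eq_le.
have := trpos_subgradient a UU XE UU' XE'; have := trpos_subgradient a UU' XE' UU XE.
by rewrite subrr !mulmx0 mxtrace0 !subr_le0 => -> ->.
Qed.

(** The squared Hilbert-Schmidt norm of a projector is its rank. *)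
Lemma sum_above_sqr_le U lam (a : R) : U^T *m U = 1%:M ->
  \sum_i \sum_j fcalc U lam (above a) i j ^+ 2 <= n%:R.
Proof.
move=> UU; set P := fcalc _ _ _.
have -> : \sum_i \sum_j P i j ^+ 2 = \tr (P *m P^T).
  by move: P => Q; apply: eq_bigr => i _; rewrite mxE; apply: eq_bigr => j _; rewrite mxE expr2.
rewrite tr_fcalc fcalcM // mxtrace_fcalc //.
apply: (@le_trans _ _ (\sum_(i < n) 1)); last by rewrite sumr_const card_ord.
by apply: ler_sum => i _; rewrite /above; case: ifP; rewrite ?mul1r ?mul0r.
Qed.

End PositivePartTrace.

Lemma mxtrace_mul_delta (R : realType) (n : nat) (Q : 'M[R]_n) i j : Q^T = Q ->
  \tr (Q *m (delta_mx i j + delta_mx j i)) = 2 * Q i j.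
Proof.
move=> QT; have h := mul_delta_mul Q 1%:M i j.
rewrite -[_ *m _]mulmx1 /mxtrace (eq_bigr _ (fun a _ => h a a)) big_split /=.
have one (p r : 'I_n) : \sum_a Q a p * 1%:M r a = Q r p.
  rewrite (bigD1 r) //= big1 ?addr0 => [|a ar]; rewrite mxE ?eqxx ?mulr1 //.
  by rewrite eq_sym (negbTE ar) mulr0.
rewrite !one; have -> : Q j i = Q i j by rewrite -[in LHS]QT mxE.
by ring.
Qed.

(** * The ramp statistic and the location of the median *)

Section Median.
Variables (R : realType) (n : nat) (dec : Omega n -> 'M[R]_n * 'rV[R]_n).
Hypothesis decP : forall s, is_eigdec (signmx R s) (dec s).1 (dec s).2.
Implicit Types (s : Omega n) (k : 'I_n).

Let UU s : (dec s).1^T *m (dec s).1 = 1%:M. Proof. by case: (decP s). Qed.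
Let XE s : signmx R s = fcalc (dec s).1 (dec s).2 id.
Proof. exact: eigdec_fcalc (decP s). Qed.

(** The subgradient bounds the decrease under a flip by [4 |P i j|], with [P] the spectral
    projector; [flip_energy_pos] makes this one-sided bound suffice, and the squares of the entries
    of [P] sum to at most [n]. *)
Lemma Variance_trpos (a : R) : Variance (fun s => trpos (dec s).2 a) <= 8 * n%:R.
Proof.
apply: le_trans (Efron_Stein _) _.
pose P s := fcalc (dec s).1 (dec s).2 (above a).
apply: (@le_trans _ _ (\sum_(b : upair n) Expect (fun s => 8 * P s (val b).1 (val b).2 ^+ 2))).
  apply: ler_sum => b _; rewrite flip_energy_pos ler_pdivrMr // mulrC -ExpectZ.
  apply: le_Expect => s.
  have := trpos_subgradient a (UU s) (XE s) (UU (flip b s)) (XE (flip b s)).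
  rewrite -/(P s) signmx_flip -(opprB (flip_mx _ _ _)) flip_mxB scaleNr opprK -scalemxAr linearZ /=.
  set i := (val b).1; set j := (val b).2.
  have -> : \tr (P s *m (delta_mx i j + delta_mx j i)) = 2 * P s i j.
    exact/mxtrace_mul_delta/tr_fcalc.
  have X1 : signmx R s i j ^+ 2 = 1.
    by apply: signmx_sqr; rewrite -val_eqE /= neq_ltn (valP b).
  move: (signmx R s i j) (P s i j) X1 => x p X1 h.
  have e : (2 * x * (2 * p)) ^+ 2 = 16 * p ^+ 2.
    by rewrite !exprMn X1; ring.
  have -> : 2 * (8 * p ^+ 2) = (2 * x * (2 * p)) ^+ 2 by rewrite e; ring.
  move: h; set d := trpos _ _ - trpos _ _ => h; have [h0|h0] := leP d 0; first by rewrite expr0n sqr_ge0.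
  by rewrite ler_pXn2r ?nnegrE // ltW // (lt_le_trans h0 h).
rewrite -Expect_sum; apply: Expect_le_const => s.
rewrite -mulr_sumr ler_wpM2l //.
apply: le_trans (sum_upair_le _) (sum_above_sqr_le (dec s).2 a (UU s)) => i j.
exact: sqr_ge0.
Qed.

Lemma trpos_neg s a : trpos (dec (neg s)).2 a = trpos (- (dec s).2) a.
Proof.
apply: (trpos_uniq (X := signmx R (neg s)) (U := (dec (neg s)).1) (U' := (dec s).1)) => //.
rewrite signmx_neg XE; apply/matrixP => i j; rewrite mxE !fcalcE -sumrN.
by apply: eq_bigr => b _; rewrite [in RHS]mxE mulNr.
Qed.

Section Scale.
Variables (y c : R).
Hypotheses (y0 : 0 < y) (c0 : 0 < c).

(** Rises from [-1] at [0] to [1] at [c]. Positive parts make its trace a combination of two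
    [trpos]. *)
Definition ramp (x : R) := -1 + 2 / c * (Num.max (x - 0) 0 - Num.max (x - c) 0).

Lemma ramp_geN1 x : -1 <= ramp x.
Proof.
rewrite /ramp lerDl mulr_ge0 ?divr_ge0 ?(ltW c0) // subr0.
by have [h1|h1] := leP x 0; have [h2|h2] := leP (x - c) 0; have := c0; lra.
Qed.

Lemma ramp1 x : c <= x -> ramp x = 1.
Proof.
move=> cx; rewrite /ramp subr0 max_l ?max_l ?subr_ge0 // ?(le_trans (ltW c0)) //.
by field; rewrite gt_eqF.
Qed.

(* The even part of the ramp is minus the tent function [(1 - |x|/c)_+], which dominates a combination of two Poisson kernels. *)
Lemma ramp_even_le x :
  ramp x + ramp (- x) <= - (y * imY y x) + 2 * (y ^+ 2 / c) * imY c x.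
Proof.
have main a : 0 <= a -> ramp a + ramp (- a) <= - (y * imY y a) + 2 * (y ^+ 2 / c) * imY c a.
  move=> a0.
  have p1 : 0 < a ^+ 2 + y ^+ 2 by exact: sqrDsqr_gt0.
  have p2 : 0 < a ^+ 2 + c ^+ 2 by exact: sqrDsqr_gt0.
  have -> : - (y * imY y a) + 2 * (y ^+ 2 / c) * imY c a =
    y ^+ 2 / (a ^+ 2 + y ^+ 2) * ((a ^+ 2 + 2 * y ^+ 2 - c ^+ 2) / (a ^+ 2 + c ^+ 2)).
    by rewrite /imY; field; rewrite !gt_eqF.
  have r0 : 0 <= y ^+ 2 / (a ^+ 2 + y ^+ 2) by rewrite divr_ge0 ?sqr_ge0 ?(ltW p1).
  have r1 : y ^+ 2 / (a ^+ 2 + y ^+ 2) <= 1.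
    by rewrite ler_pdivrMr // mul1r lerDr sqr_ge0.
  have [ca|ac] := leP c a.
    rewrite ramp1 //; have -> : ramp (- a) = -1.
      by rewrite /ramp !max_r ?subrr ?mulr0 ?addr0 //; move: c0 a0; lra.
    rewrite subrr mulr_ge0 // divr_ge0 ?(ltW p2) //.
    have : c ^+ 2 <= a ^+ 2 by rewrite ler_pXn2r ?nnegrE ?(ltW c0).
    by have := sqr_ge0 y; lra.
  have -> : ramp a + ramp (- a) = - (2 * (c - a) / c).
    rewrite /ramp (max_l (x := a - 0)) ?subr0 // !max_r; [|move: c0 a0 ac; lra..].
    by field; rewrite gt_eqF.
  (* Twice the tent is at least [(c^2 - a^2) / (c^2 + a^2)]; this is then shrunk by the factor
     [y^2 / (a^2 + y^2) <= 1], and [2 y^2] is added to the numerator. *)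
  apply: (@le_trans _ _ (- ((c ^+ 2 - a ^+ 2) / (a ^+ 2 + c ^+ 2)))).
    rewrite lerN2 ler_pdivrMr // mulrAC ler_pdivlMr //.
    rewrite -subr_ge0.
    have -> : 2 * (c - a) * (a ^+ 2 + c ^+ 2) - (c ^+ 2 - a ^+ 2) * c =
      (c - a) * (2 * a ^+ 2 + c * (c - a)) by ring.
    have ca : 0 <= c - a by rewrite subr_ge0 ltW.
    by apply: mulr_ge0 => //; apply: addr_ge0; apply: mulr_ge0; rewrite ?sqr_ge0 ?(ltW c0).
  apply: (@le_trans _ _ (y ^+ 2 / (a ^+ 2 + y ^+ 2) * (- ((c ^+ 2 - a ^+ 2) / (a ^+ 2 + c ^+ 2))))).
    have : 0 <= (c ^+ 2 - a ^+ 2) / (a ^+ 2 + c ^+ 2).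
      by rewrite divr_ge0 ?(ltW p2) // subr_ge0 ler_pXn2r ?nnegrE ?(ltW c0) ?(ltW ac).
    by nra.
  rewrite ler_wpM2l // -mulNr ler_pM2r ?invr_gt0 //.
  by have := sqr_ge0 y; lra.
have [x0|x0] := leP 0 x; first exact: main.
have := main (- x); rewrite oppr_ge0 (ltW x0) opprK addrC => /(_ erefl).
by rewrite /imY sqrrN.
Qed.

Definition rampsum s := \sum_i ramp ((dec s).2 0 i).

Lemma rampsumE s : rampsum s = 2 / c * (trpos (dec s).2 0 - trpos (dec s).2 c) - n%:R.
Proof.
rewrite /rampsum /trpos -sumrB mulr_sumr.
rewrite [X in _ = _ - X](_ : _ = \sum_(i < n) 1); last by rewrite sumr_const card_ord.
by rewrite -sumrB; apply: eq_bigr => i _; rewrite /ramp; ring.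
Qed.

Lemma rampsum_neg s : rampsum (neg s) = \sum_i ramp (- (dec s).2 0 i).
Proof.
rewrite rampsumE !trpos_neg /trpos -sumrB mulr_sumr.
rewrite [X in _ - X = _](_ : _ = \sum_(i < n) 1); last by rewrite sumr_const card_ord.
by rewrite -sumrB; apply: eq_bigr => i _; rewrite /ramp mxE; ring.
Qed.

Lemma Variance_rampsum : Variance rampsum <= 128 * n%:R / c ^+ 2.
Proof.
have -> : Variance rampsum =
  Variance (fun s => 2 / c * (trpos (dec s).2 0 - trpos (dec s).2 c) + - n%:R).
  by rewrite /Variance (eq_Expect rampsumE); apply: eq_Expect => s; rewrite rampsumE.
rewrite Variance_addc VarianceZ.
have -> : 128 * n%:R / c ^+ 2 = (2 / c) ^+ 2 * (2 * (8 * n%:R + 8 * n%:R)).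
  by field; rewrite gt_eqF.
rewrite ler_wpM2l ?sqr_ge0 //; apply: le_trans (VarianceB_le _ _) _.
by rewrite ler_wpM2l // lerD // Variance_trpos.
Qed.

Lemma Expect_rampsum_le :
  Expect rampsum <= - (y * theta dec y) / 2 + y ^+ 2 / c * theta dec c.
Proof.
have h := Expect_bij rampsum (@neg_inj n).
suff : Expect (fun s => rampsum s + rampsum (neg s)) <=
   - (y * theta dec y) + 2 * (y ^+ 2 / c) * theta dec c.
  by rewrite ExpectD h; lra.
rewrite /theta -!ExpectZ -ExpectN -ExpectD; apply: le_Expect => s.
rewrite rampsum_neg /rampsum -big_split /= !mxtrace_fcalc // !mulr_sumr -sumrN -big_split.
by apply: ler_sum => i _; apply: ramp_even_le.
Qed.

End Scale.

Section BadEvent.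
Variable c : R.
Hypothesis c0 : 0 < c.

Let decr s (i j : 'I_n) : (i <= j)%N -> (dec s).2 0 j <= (dec s).2 0 i.
Proof. by case: (decP s) => _ _; apply. Qed.

Lemma sum_rev_ge0 (g : 'I_n -> R) :
  (forall i, 0 <= g i + g (rev_ord i)) -> 0 <= \sum_i g i.
Proof.
move=> h; have : 0 <= \sum_i (g i + g (rev_ord i)) by apply: sumr_ge0.
by rewrite big_split /= -(reindex_inj rev_ord_inj (P := xpredT)) /=; lra.
Qed.

(** The ramp is [1] at all indices up to [n./2], and each pair [j], [rev_ord j] contains such an
    index; the other value is at least [-1]. Indices start at [0], so [n./2] is the first one left
    out of [Xplus]. *)
Lemma rampsum_ge0_top s (i : 'I_n) : (n./2 <= i)%N -> c < (dec s).2 0 i -> 0 <= rampsum c s.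
Proof.
move=> ni ci; apply: sum_rev_ge0 => j.
have h1 (l : 'I_n) : (l <= n./2)%N -> ramp c ((dec s).2 0 l) = 1.
  move=> ln; apply: ramp1 => //; apply: le_trans (ltW ci) _.
  by apply: decr; apply: leq_trans ni.
have b1 := ramp_geN1 c0 ((dec s).2 0 j); have b2 := ramp_geN1 c0 ((dec s).2 0 (rev_ord j)).
have [jn|jn] := leqP j n./2; first by rewrite (h1 j jn); lra.
rewrite (h1 (rev_ord j)); first by lra.
by move: jn; rewrite /=; lia.
Qed.

Lemma rampsum_neg_ge0_bottom s (i : 'I_n) : (i < n./2)%N -> (dec s).2 0 i < - c -> 0 <= rampsum c (neg s).
Proof.
move=> ni ci; rewrite rampsum_neg; apply: sum_rev_ge0 => j.
have h1 (l : 'I_n) : (i <= l)%N -> ramp c (- (dec s).2 0 l) = 1.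
  move=> il; apply: ramp1 => //; rewrite lerNr; apply: le_trans (ltW ci).
  exact: decr.
have b1 := ramp_geN1 c0 (- (dec s).2 0 j); have b2 := ramp_geN1 c0 (- (dec s).2 0 (rev_ord j)).
have [ij|ji] := leqP i j; first by rewrite (h1 j ij); lra.
rewrite (h1 (rev_ord j)); first by lra.
by move: ni ji (ltn_ord j); rewrite /=; lia.
Qed.

(** The masses of the spectral measure of [X] at the [k]-th basis vector. *)
Definition weight s k i := (dec s).1 k i ^+ 2.
Definition absX s k := fcalc (dec s).1 (dec s).2 Num.norm k k.
Definition plus_diff s k := Xplus (dec s).1 (dec s).2 k k - absX s k / 2.

Lemma weight_ge0 s k i : 0 <= weight s k i. Proof. exact: sqr_ge0. Qed.

Lemma sum_weight s k : \sum_i weight s k i = 1.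
Proof. exact: sum_row_sqr (dec s).2 (UU s) k. Qed.

Lemma fcalc_diag s k g :
  fcalc (dec s).1 (dec s).2 g k k = \sum_i g ((dec s).2 0 i) * weight s k i.
Proof. by rewrite fcalcE; apply: eq_bigr => i _; rewrite -expr2. Qed.

(** The left side is the diagonal entry of [X^2], which counts the nonzero entries of a row. *)
Lemma sum_lam_sqr_le s k : \sum_i (dec s).2 0 i ^+ 2 * weight s k i <= n%:R.
Proof.
rewrite -(fcalc_diag s k (fun x => x ^+ 2)).
have -> : fcalc (dec s).1 (dec s).2 (fun x => x ^+ 2) = signmx R s *m signmx R s.
  by rewrite XE fcalcM //; apply: eq_fcalc => x; rewrite expr2.
rewrite mxE; apply: (@le_trans _ _ (\sum_(i < n) 1)); last by rewrite sumr_const card_ord.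
apply: ler_sum => j _; rewrite (signmx_symE R s j k) -expr2.
by have [->|jk] := eqVneq j k; rewrite ?signmx_diag ?expr0n // signmx_sqr // eq_sym.
Qed.

(** Adding half of [X k k = 0] turns [|X| / 2] into the positive part on the diagonal, so only
    eigenvalues on the wrong side of the median index contribute. *)
Lemma plus_diffE s k : plus_diff s k =
  \sum_(i < n) ((if (i < n./2)%N then (dec s).2 0 i else 0) - Num.max ((dec s).2 0 i) 0) * weight s k i.
Proof.
have x0 : \sum_i (dec s).2 0 i * weight s k i = 0.
  by rewrite -(fcalc_diag s k id) -XE signmx_diag.
rewrite /plus_diff /absX fcalc_diag.
have -> : Xplus (dec s).1 (dec s).2 k k =
   \sum_(i < n) (if (i < n./2)%N then (dec s).2 0 i else 0) * weight s k i.
  rewrite /Xplus summxE big_mkcond; apply: eq_bigr => i _; case: ifP => _; last by rewrite mul0r.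
  by rewrite !mxE big_ord_recl big_ord0 addr0 !mxE /weight expr2.
have -> : (\sum_i `|(dec s).2 0 i| * weight s k i) / 2 =
  (\sum_i `|(dec s).2 0 i| * weight s k i) / 2 + (\sum_i (dec s).2 0 i * weight s k i) / 2.
  by rewrite x0 mul0r addr0.
rewrite -mulrDl -big_split /= mulr_suml -sumrB; apply: eq_bigr => i _.
move: ((dec s).2 0 i) (weight s k i) => l w.
by have [h|h] := leP l 0; rewrite ?(ler0_norm h) ?(gtr0_norm h); field.
Qed.

Lemma plus_diff_le s k :
  (forall i : 'I_n, (n./2 <= i)%N -> (dec s).2 0 i <= c) ->
  (forall i : 'I_n, (i < n./2)%N -> - c <= (dec s).2 0 i) -> plus_diff s k ^+ 2 <= c ^+ 2.
Proof.
move=> h1 h2; rewrite -real_normK ?num_real // ler_pXn2r ?nnegrE ?(ltW c0) //.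
rewrite plus_diffE; apply: le_trans (ler_norm_sum _ _ _) _.
rewrite -[leRHS]mulr1 -(sum_weight s k) mulr_sumr; apply: ler_sum => i _.
rewrite normrM (ger0_norm (weight_ge0 _ _ _)) ler_wpM2r ?weight_ge0 //.
have := c0; have := h1 i; have := h2 i; case: ltnP => ni.
  move=> /(_ isT) a _ b; rewrite ler_norml.
  by have [h|h] := leP ((dec s).2 0 i) 0; apply/andP; split; lra.
move=> _ /(_ isT) a b; rewrite ler_norml.
by have [h|h] := leP ((dec s).2 0 i) 0; apply/andP; split; lra.
Qed.

(** The difference is at most the mean of [|lam|] under the spectral measure, whose square is at
    most the second moment. *)
Lemma plus_diff_le_n s k : plus_diff s k ^+ 2 <= n%:R.
Proof.
apply: le_trans (sum_lam_sqr_le s k).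
set l := (dec s).2; set w := weight s k.
pose m := \sum_i `|l 0 i| * w i.
have dm : `|plus_diff s k| <= m.
  rewrite plus_diffE; apply: le_trans (ler_norm_sum _ _ _) _; apply: ler_sum => i _.
  rewrite normrM (ger0_norm (weight_ge0 _ _ _)) ler_wpM2r ?weight_ge0 //.
  rewrite -/l; case: ifP => _; case: (leP (l 0 i) 0) => h; rewrite ?subrr ?subr0 ?normr0 //.
  by rewrite sub0r normrN.
have : 0 <= \sum_i (`|l 0 i| - m) ^+ 2 * w i.
  by apply: sumr_ge0 => i _; rewrite mulr_ge0 ?sqr_ge0.
have -> : \sum_i (`|l 0 i| - m) ^+ 2 * w i = \sum_i l 0 i ^+ 2 * w i - m ^+ 2.
  have -> : \sum_i (`|l 0 i| - m) ^+ 2 * w i =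
    \sum_i (l 0 i ^+ 2 * w i - 2 * m * (`|l 0 i| * w i) + m ^+ 2 * w i).
    apply: eq_bigr => i _; rewrite -[l 0 i ^+ 2](real_normK (num_real _)); ring.
  rewrite big_split /= sumrB -!mulr_sumr -/m (sum_weight s k); ring.
rewrite subr_ge0; apply: le_trans.
rewrite -[plus_diff s k ^+ 2](real_normK (num_real _)) ler_pXn2r ?nnegrE //.
exact: le_trans dm.
Qed.

(** [dev] is at least [1] wherever the ramp sum is nonnegative, as in Chebyshev's inequality.
    Evaluated at [s] and [neg s] it covers the failures at the top and at the bottom, where the
    bound [n] is used. *)
Lemma Expect_plus_diff_sqr k (m : R) : 0 < m -> Expect (rampsum c) <= - m ->
  Expect (fun s => plus_diff s k ^+ 2) <= c ^+ 2 + 2 * n%:R * (Variance (rampsum c) / m ^+ 2).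
Proof.
move=> m0 Em; set e := Expect (rampsum c) in Em.
pose dev s := (rampsum c s - e) ^+ 2 / m ^+ 2.
have dev0 s : 0 <= dev s by rewrite divr_ge0 ?sqr_ge0.
have dev1 s : 0 <= rampsum c s -> 1 <= dev s.
  move=> h; rewrite ler_pdivlMr ?exprn_gt0 // mul1r ler_pXn2r ?nnegrE ?(ltW m0) //; lra.
have -> : c ^+ 2 + 2 * n%:R * (Variance (rampsum c) / m ^+ 2) =
  Expect (fun s => c ^+ 2 + n%:R * (dev s + dev (neg s))).
  rewrite ExpectD Expect_const ExpectZ ExpectD (Expect_bij dev (@neg_inj n)).
  have -> : Expect dev = Variance (rampsum c) / m ^+ 2.
    rewrite /Variance [RHS]mulrC -ExpectZ; apply: eq_Expect => s; rewrite mulrC //.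
  by ring.
apply: le_Expect => s.
have nn : 0 <= n%:R :> R by [].
case: (boolP [forall i : 'I_n, (n./2 <= i)%N ==> ((dec s).2 0 i <= c)]) => [/forallP h1|].
  case: (boolP [forall i : 'I_n, (i < n./2)%N ==> (- c <= (dec s).2 0 i)]) => [/forallP h2|].
    apply: (@le_trans _ _ (c ^+ 2)); last by rewrite lerDl mulr_ge0 ?addr_ge0.
    by apply: plus_diff_le => i hi; [have := h1 i|have := h2 i]; rewrite hi.
  rewrite negb_forall => /existsP[i]; rewrite negb_imply -ltNge => /andP[h2 h3].
  have := dev1 _ (rampsum_neg_ge0_bottom h2 h3); have := dev0 s.
  move: (dev s) (dev (neg s)) => u v u0 v1; have := plus_diff_le_n s k.
  have := ler_wpM2l nn (_ : 1 <= u + v); rewrite mulr1.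
  by have := sqr_ge0 c; move=> ? /(_ _); lra.
rewrite negb_forall => /existsP[i]; rewrite negb_imply -ltNge => /andP[h2 h3].
have := dev1 _ (rampsum_ge0_top h2 h3); have := dev0 (neg s).
move: (dev s) (dev (neg s)) => u v v0 u1; have := plus_diff_le_n s k.
have := ler_wpM2l nn (_ : 1 <= u + v); rewrite mulr1.
by have := sqr_ge0 c; move=> ? /(_ _); lra.
Qed.

End BadEvent.
End Median.

(** * The second moment of the diagonal entries *)

Section SecondMoment.
Variables (R : realType) (n : nat) (dec : Omega n -> 'M[R]_n * 'rV[R]_n).
Hypothesis decP : forall s, is_eigdec (signmx R s) (dec s).1 (dec s).2.
Variables (q : R) (M : nat).
Hypothesis q16 : 16 <= q.
Hypothesis qn : q ^+ 4 = n%:R.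
Hypothesis qM : q ^+ 2 <= M%:R <= 2 * q ^+ 2.

Let q0 : 0 < q. Proof. exact: lt_le_trans q16. Qed.
Let q1 : 1 <= q. Proof. by apply: le_trans q16; rewrite ler1n. Qed.
Let h := 8 * q.
Let h0 : 0 < h. Proof. by rewrite mulr_gt0. Qed.
Let M0 : (0 < M)%N.
Proof.
by rewrite -(ltr0n R); have /andP[qM1 _] := qM; apply: lt_le_trans qM1; rewrite exprn_gt0.
Qed.

Definition height (i : nat) : R := i.+1%:R * h.

Lemma height_ge i : 8 * q <= height i.
Proof. by rewrite /height ler_peMl ?(ltW h0) // ler1n. Qed.

Lemma height_gt0 i : 0 < height i.
Proof. by rewrite mulr_gt0 ?ltr0n. Qed.

(* Riemann sum for [|x| = (2 / pi) * int_0^oo x^2 / (x^2 + y^2) dy], applied to [X], with step [h]. *)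
Definition absX_sum k s := \sum_(i < M) h * (1 - height i * Ymx dec (height i) s k k).

Lemma absX_sumE k s :
  absX_sum k s = \sum_a abs_sum h M ((dec s).2 0 a) * weight dec s k a.
Proof.
rewrite /absX_sum /abs_sum.
under [RHS]eq_bigr do rewrite mulr_suml.
rewrite [RHS]exchange_big; apply: eq_bigr => i _ /=.
rewrite /Ymx (fcalc_diag dec) -[X in X - _](sum_weight decP s k).
rewrite mulr_sumr -sumrB mulr_sumr; apply: eq_bigr => a _.
have := sqrDsqr_gt0 ((dec s).2 0 a) (height_gt0 i).
rewrite /imY /height; move: (_ * h) (weight _ _ _ _) => y w p.
by field; rewrite gt_eqF.
Qed.

Lemma absX_sum_approx k s : `|pi / 2 * absX dec s k - absX_sum k s| <= 9 * q.
Proof.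
rewrite absX_sumE /absX (fcalc_diag dec) mulr_sumr -sumrB.
apply: le_trans (ler_norm_sum _ _ _) _.
apply: (@le_trans _ _ (\sum_a (h * weight dec s k a +
   (M%:R * h)^-1 * ((dec s).2 0 a ^+ 2 * weight dec s k a)))).
  apply: ler_sum => a _; rewrite mulrA -mulrBl normrM (ger0_norm (weight_ge0 _ _ _ _)).
  have := ler_wpM2r (weight_ge0 dec s k a) (abs_sum_approx ((dec s).2 0 a) h0 M0).
  move=> /le_trans; apply; rewrite le_eqVlt; apply/orP; left; apply/eqP; ring.
rewrite big_split /= -!mulr_sumr (sum_weight decP) mulr1.
have Mh : 0 < M%:R * h by rewrite mulr_gt0 ?ltr0n.
apply: (@le_trans _ _ (h + q ^+ 4 / (M%:R * h))).
  rewrite lerD2l mulrC ler_wpM2r ?invr_ge0 ?(ltW Mh) // qn.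
  exact: sum_lam_sqr_le.
have /andP[qM1 _] := qM.
have : q ^+ 4 / (M%:R * h) <= q.
  rewrite ler_pdivrMr // /h.
  have -> : q * (M%:R * (8 * q)) = 8 * (q ^+ 2 * M%:R) by ring.
  have -> : q ^+ 4 = q ^+ 2 * q ^+ 2 by ring.
  have := ler_wpM2l (sqr_ge0 q) qM1; have := mulr_ge0 (sqr_ge0 q) (ler0n R M); lra.
by rewrite /h; lra.
Qed.

Lemma Variance_absX_sum k : Variance (absX_sum k) <= (36 * q) ^+ 2.
Proof.
(* With [m = i + 1] the standard deviation is of order [1 / m + q / m^2]. Trading [1 / m] for
   [1 / q + q / m^2] avoids a logarithm: the weights sum to at most [6 q + 30 q], as
   [M <= 2 q^2]. *)
pose w (i : nat) := 3 / q + 15 * q * (i.+1%:R ^+ 2)^-1.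
have w0 i : 0 < w i.
  by rewrite addr_gt0 ?divr_gt0 ?mulr_gt0 ?invr_gt0 ?exprn_gt0 ?ltr0n.
have := @Variance_sum_le R n M (fun i s => h * (1 - height i * Ymx dec (height i) s k k)) w w0.
have Fw i : Variance (fun s => h * (1 - height i * Ymx dec (height i) s k k)) <= w i ^+ 2.
  have y0 := height_gt0 i.
  have y16 : 16 <= height i by apply: le_trans (height_ge i); move: q16; lra.
  have -> : Variance (fun s => h * (1 - height i * Ymx dec (height i) s k k)) =
    (h * height i) ^+ 2 * Variance (fun s => Ymx dec (height i) s k k).
    rewrite -sqrrN -VarianceZ -[RHS](Variance_addc h) /Variance.
    have e s : h * (1 - height i * Ymx dec (height i) s k k) =
      - (h * height i) * Ymx dec (height i) s k k + h by ring.
    by rewrite (eq_Expect e); apply: eq_Expect => s; rewrite e.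
  apply: le_trans (ler_wpM2l (sqr_ge0 _) (Variance_Ykk decP y0 k y16)) _.
  rewrite -qn /w; have m0 : 0 < i.+1%:R :> R by rewrite ltr0n.
  have -> : (h * height i) ^+ 2 * (32 / height i ^+ 4 + 8192 * q ^+ 4 / height i ^+ 6) =
     32 * (i.+1%:R ^+ 2)^-1 + 128 * q ^+ 2 * ((i.+1%:R ^+ 2)^-1) ^+ 2.
    rewrite /height /h; move: (i.+1%:R : R) m0 => m m0.
    by field; rewrite !gt_eqF.
  have -> : (3 / q + 15 * q * (i.+1%:R ^+ 2)^-1) ^+ 2 =
    9 / q ^+ 2 + 90 * (i.+1%:R ^+ 2)^-1 + 225 * q ^+ 2 * ((i.+1%:R ^+ 2)^-1) ^+ 2.
    by move: (i.+1%:R : R) m0 => m m0; field; rewrite !gt_eqF.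
  move: (i.+1%:R : R) m0 => m m0.
  have a1 : 0 <= 9 / q ^+ 2 by rewrite divr_ge0 ?sqr_ge0.
  have a2 : 0 <= (m ^+ 2)^-1 by rewrite invr_ge0 sqr_ge0.
  have a3 : 0 <= q ^+ 2 * ((m ^+ 2)^-1) ^+ 2 by rewrite mulr_ge0 ?sqr_ge0.
  by lra.
move=> /(_ Fw) /le_trans; apply.
have s0 : 0 <= \sum_(i < M) w i by rewrite sumr_ge0 // => i _; apply: ltW.
rewrite ler_pXn2r ?nnegrE ?mulr_ge0 ?(ltW q0) //.
rewrite /w big_split /= sumr_const card_ord -[_ *+ M]mulr_natl -mulr_sumr.
have /andP[_ qM2] := qM.
have : M%:R * (3 / q) <= 6 * q.
  rewrite mulrA ler_pdivrMr //; move: qM2; lra.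
have q15 : 0 <= 15 * q by rewrite mulr_ge0 // ltW.
have := ler_wpM2l q15 (sum_inv_sqr_le R M); lra.
Qed.

Lemma Expect_absX_sum k : `|Expect (absX_sum k) - 4 / 3 * q ^+ 2| <= 14 * q.
Proof.
have /andP[qM1 _] := qM.
have n0 : 0 < q ^+ 4 by rewrite exprn_gt0.
have sc := semicircle_sum q0 (erefl h) M0 qM1.
set S := \sum_(i < M) _ in sc.
suff d : `|Expect (absX_sum k) - S| <= 5 * q.
  have := ler_normD (Expect (absX_sum k) - S) (S - 4 / 3 * q ^+ 2).
  by rewrite addrA subrK; lra.
rewrite /absX_sum Expect_sum /S -sumrB.
apply: le_trans (ler_norm_sum _ _ _) _.
(* At height [m h] with [h = 8 q], the error [17 (q / y)^2] times [h] equals [17 / 8 * q / m^2]. *)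
apply: (@le_trans _ _ (\sum_(i < M) 17 / 8 * q * (i.+1%:R ^+ 2)^-1)).
  apply: ler_sum => i _; have y0 := height_gt0 i.
  have [t0 tE] := theta0P n0 (ltW y0).
  set t := theta0 _ _ in t0 tE.
  have tE' : t ^+ 2 + height i * t = n%:R by rewrite tE.
  have := Expect_Ykk_approx decP q1 qn (height_ge i) k t0 tE'.
  rewrite ExpectZ ExpectB Expect_const ExpectZ -/(height i) -/t -mulrBr normrM (gtr0_norm h0).
  set a := height i * Expect _ => hh.
  have -> : 1 - a - t ^+ 2 / q ^+ 4 = - (a - height i * t / n%:R).
    have -> : t ^+ 2 / q ^+ 4 = 1 - height i * t / n%:R.
      rewrite -qn; have -> : t ^+ 2 = q ^+ 4 - height i * t by rewrite -tE addrK.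
      by field; rewrite gt_eqF.
    by ring.
  rewrite normrN; apply: le_trans (ler_wpM2l (ltW h0) hh) _.
  rewrite le_eqVlt; apply/orP; left; apply/eqP; rewrite /height /h.
  have m0 : 0 < i.+1%:R :> R by rewrite ltr0n.
  by move: (i.+1%:R : R) m0 => m m0; field; rewrite !gt_eqF.
rewrite -mulr_sumr.
have q15 : 0 <= 17 / 8 * q by move: q0; lra.
have := ler_wpM2l q15 (sum_inv_sqr_le R M); lra.
Qed.

Lemma Expect_plus_diff k : Expect (fun s => plus_diff dec s k ^+ 2) <= (256 ^+ 2 + 1) * q ^+ 2.
Proof.
(* Then [h^2 / c = q / 4], so the negative term [- 2 q^3] from height [h] beats the [q^3 / 2] from
   height [c]. *)
pose c := 32 * h; have c0 : 0 < c by rewrite mulr_gt0.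
have hq : 8 * q <= h by [].
have cq : 8 * q <= c by rewrite /c /h; move: q1; lra.
have hq2 : h <= q ^+ 2 / 2.
  (* This is where [q >= 16] is needed: [8 q <= q^2 / 2]. *)
  by rewrite ler_pdivlMr // /h expr2 mulrAC ler_wpM2r ?(ltW q0) //; move: q16; lra.
have tg := theta_ge decP q1 qn hq hq2.
have tl := theta_le decP q1 qn cq.
have m0 : 0 < q ^+ 3 by rewrite exprn_gt0.
have Em : Expect (rampsum dec c) <= - q ^+ 3.
  apply: le_trans (Expect_rampsum_le decP h0 c0) _.
  have -> : h ^+ 2 / c = q / 4 by rewrite /c /h; field; rewrite gt_eqF.
  have := ler_wpM2l (ltW h0) tg; have := ler_wpM2l (ltW q0) tl.
  rewrite /h; lra.
apply: le_trans (Expect_plus_diff_sqr decP c0 k m0 Em) _.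
have v := Variance_rampsum decP c0.
have : Variance (rampsum dec c) / (q ^+ 3) ^+ 2 <= 128 * n%:R / c ^+ 2 / (q ^+ 3) ^+ 2.
  by rewrite ler_wpM2r // invr_ge0 sqr_ge0.
have n2 : 0 <= 2 * n%:R :> R by rewrite mulr_ge0.
move=> /(ler_wpM2l n2) hv; apply: le_trans (lerD (lexx _) hv) _.
have -> : 2 * n%:R * (128 * n%:R / c ^+ 2 / (q ^+ 3) ^+ 2) = 256^-1.
  by rewrite -qn /c /h; field; rewrite gt_eqF.
have : 1 <= q ^+ 2 by rewrite expr_ge1 // ltW.
rewrite /c /h; lra.
Qed.

Lemma Expect_Xplus_sqr k :
  Expect (fun s => (Xplus (dec s).1 (dec s).2 k k - 4 / (3 * pi) * q ^+ 2) ^+ 2)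
  <= 600 ^+ 2 * q ^+ 2.
Proof.
have p2 : 2 <= pi :> R by have := @pihalf_ge1 R; lra.
have p0 : 0 < pi :> R by apply: lt_le_trans p2.
have ip : pi^-1 <= 1 :> R by rewrite invf_le1 // (le_trans _ p2) // ler1n.
have ip0 : 0 <= pi^-1 :> R by rewrite invr_ge0 ltW.
have ip2 : pi^-1 ^+ 2 <= 1 :> R by rewrite expr_le1.
(* The four errors are the median eigenvalues, the discretisation, the fluctuation of the Riemann
   sum and the bias of its mean. *)
have decomp (p A B w e' c : R) : 0 < p -> A - 4 / (3 * p) * c =
    (A - B / 2) + (p / 2 * B - w) / p + (w - e') / p + (e' - 4 / 3 * c) / p.
  by move=> pp; field; rewrite gt_eqF.
set W := absX_sum k; set e := Expect W.
have sq b (x : R) : 0 <= b -> `|x| <= b -> (x / pi) ^+ 2 <= b ^+ 2.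
  move=> b0 xb; rewrite exprMn -[leRHS]mulr1; apply: ler_pM; rewrite ?sqr_ge0 //.
  by rewrite -(real_normK (num_real x)) ler_pXn2r ?nnegrE.
have hM : (e - 4 / 3 * q ^+ 2) / pi * ((e - 4 / 3 * q ^+ 2) / pi) <= (14 * q) ^+ 2.
  rewrite -expr2; apply: sq; first by rewrite mulr_ge0 // ltW.
  exact: Expect_absX_sum.
apply: (@le_trans _ _ (Expect (fun s => 4 * (plus_diff dec s k ^+ 2 + (9 * q) ^+ 2 +
    (W s - e) ^+ 2 + (14 * q) ^+ 2)))).
  apply: le_Expect => s.
  have hA : ((pi / 2 * absX dec s k - W s) / pi) ^+ 2 <= (9 * q) ^+ 2.
    apply: sq; first by rewrite mulr_ge0 // ltW.
    exact: absX_sum_approx.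
  have hV : ((W s - e) / pi) ^+ 2 <= (W s - e) ^+ 2.
    by rewrite exprMn ler_piMr ?sqr_ge0.
  have -> : Xplus (dec s).1 (dec s).2 k k - 4 / (3 * pi) * q ^+ 2 =
    plus_diff dec s k + (pi / 2 * absX dec s k - W s) / pi + (W s - e) / pi +
    (e - 4 / 3 * q ^+ 2) / pi.
    exact: decomp.
  rewrite -expr2 in hM; move: hA hV hM.
  move: (plus_diff _ _ _) ((pi / 2 * absX dec s k - W s) / pi) ((W s - e) / pi)
    ((e - 4 / 3 * q ^+ 2) / pi) ((9 * q) ^+ 2) ((14 * q) ^+ 2) ((W s - e) ^+ 2).
  move=> a b c d B D C hB hC hD.
  have := sqr_ge0 (a - b); have := sqr_ge0 (a - c); have := sqr_ge0 (a - d).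
  have := sqr_ge0 (b - c); have := sqr_ge0 (b - d); have := sqr_ge0 (c - d).
  by lra.
rewrite ExpectZ !ExpectD !Expect_const -/(Variance W).
have := Expect_plus_diff k; have := Variance_absX_sum k; rewrite -/W.
have := sqr_ge0 q; lra.
Qed.

End SecondMoment.

(** * Normalisation and the two asymptotic claims *)

Section Asymptotics.
Variable R : realType.

Lemma fourth_root (n : nat) : (16 ^ 4 <= n)%N ->
  exists q : R, [/\ 16 <= q, q ^+ 4 = n%:R, q ^+ 2 = Num.sqrt n%:R &
    exists M : nat, q ^+ 2 <= M%:R <= 2 * q ^+ 2].
Proof.
move=> n1; pose q : R := Num.sqrt (Num.sqrt n%:R).
have q0 : 0 <= q by apply: sqrtr_ge0.
have q2 : q ^+ 2 = Num.sqrt n%:R by rewrite sqr_sqrtr // sqrtr_ge0.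
have q4 : q ^+ 4 = n%:R by rewrite (exprM q 2 2) q2 sqr_sqrtr.
have q16 : 16 <= q.
  by rewrite -(@ler_pXn2r _ 4) ?nnegrE // q4 -natrX ler_nat.
exists q; split => //; exists (Num.truncn (q ^+ 2)).+1.
have /andP[t1 t2] := truncn_itv (sqr_ge0 q).
rewrite (ltW t2) /= -natr1.
have : 1 <= q ^+ 2 by rewrite expr_ge1 // (le_trans _ q16) // ler1n.
lra.
Qed.

Variables (n : nat) (dec : Omega n -> 'M[R]_n * 'rV[R]_n).
Hypothesis decP : forall s, is_eigdec (signmx R s) (dec s).1 (dec s).2.
Hypothesis n1 : (16 ^ 4 <= n)%N.

Lemma Expect_normalized_Xplus_sqr k :
  Expect (fun s => (Xplus (dec s).1 (dec s).2 k k / Num.sqrt n%:R - 4 / (3 * pi)) ^+ 2)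
  <= 600 ^+ 2 / Num.sqrt n%:R.
Proof.
have [q [q16 q4 q2 [M qM]]] := fourth_root n1.
have h := Expect_Xplus_sqr decP q16 q4 qM k; rewrite -q2.
have q0 : 0 < q by apply: lt_le_trans q16.
have p0 : 0 < pi :> R := pi_gt0 R.
have -> : 600 ^+ 2 / q ^+ 2 = (q ^+ 2) ^- 2 * (600 ^+ 2 * q ^+ 2) by field; rewrite gt_eqF.
apply: le_trans (ler_wpM2l _ h); last by rewrite invr_ge0 exprn_ge0 ?sqr_ge0.
rewrite -ExpectZ; apply: le_Expect => s; rewrite le_eqVlt; apply/orP; left; apply/eqP.
by move: (pi : R) p0 (Xplus _ _ _ _) => p p0 x; field; rewrite !gt_eqF.
Qed.

End Asymptotics.

(** Both claims come from one second moment about [4 / (3 pi)]: Jensen's inequality gives the mean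
    and Chebyshev's the tail. [dec] is an arbitrary choice of eigendecomposition for each sample. *)
Theorem theoremG1 (R : realType) :
  (forall eps : R, 0 < eps -> exists N : nat, forall n : nat,
     ~~ odd n -> (N <= n)%N -> forall (k : 'I_n)
     (dec : Omega n -> 'M[R]_n * 'rV[R]_n),
     (forall s, is_eigdec (signmx R s) (dec s).1 (dec s).2) ->
     `| Expect (fun s => Xplus (dec s).1 (dec s).2 k k) / Num.sqrt (n%:R)
        - 4 / (3 * pi) | <= eps)
  /\
  (exists C : R, exists N : nat, forall n : nat,
     ~~ odd n -> (N <= n)%N -> forall (k : 'I_n)
     (dec : Omega n -> 'M[R]_n * 'rV[R]_n),
     (forall s, is_eigdec (signmx R s) (dec s).1 (dec s).2) ->
     forall t : R, 0 < t ->
     Prob R (fun s => t <= `| Xplus (dec s).1 (dec s).2 k k / Num.sqrt (n%:R)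
          - Expect (fun s' => Xplus (dec s').1 (dec s').2 k k) / Num.sqrt (n%:R) |)
       <= C / (t ^+ 2 * Num.sqrt (n%:R))).
Proof.
have EV n (f : Omega n -> R) (r : R) : Expect f / r = Expect (fun s => f s / r).
  by rewrite mulrC -ExpectZ; apply: eq_Expect => s; rewrite mulrC.
split.
  move=> eps e0.
  (* For [n >= A] the second moment [600^2 / sqrt n] is at most [eps^2]. *)
  pose A := (600 ^+ 2 / eps ^+ 2) ^+ 2 : R.
  exists (maxn (16 ^ 4) (Num.truncn A).+1) => n _; rewrite geq_max => /andP[n1 nA] k dec decP.
  pose f s := Xplus (dec s).1 (dec s).2 k k / Num.sqrt n%:R - 4 / (3 * pi).
  have h : Expect (fun s => f s ^+ 2) <= 600 ^+ 2 / Num.sqrt n%:R.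
    exact: Expect_normalized_Xplus_sqr.
  have -> : Expect (fun s => Xplus (dec s).1 (dec s).2 k k) / Num.sqrt n%:R - 4 / (3 * pi) =
    Expect f by rewrite ExpectB Expect_const EV.
  have s0 : 0 < Num.sqrt (n%:R : R) by rewrite sqrtr_gt0 ltr0n (leq_trans _ n1) // expn_gt0.
  have e2 : Expect f ^+ 2 <= eps ^+ 2.
    apply: le_trans (Expect_sqr_le f) _; apply: le_trans h _.
    rewrite ler_pdivrMr // mulrC -ler_pdivrMr ?exprn_gt0 //.
    rewrite -[leLHS]ger0_norm ?divr_ge0 ?sqr_ge0 // -sqrtr_sqr ler_sqrt ?ler0n //.
    apply: ltW; apply: lt_le_trans (truncnS_gt A) _.
    by rewrite ler_nat.
  by rewrite -(@ler_pXn2r _ 2) ?nnegrE ?(ltW e0) // real_normK ?num_real.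
exists (600 ^+ 2), (16 ^ 4)%N => n _ n1 k dec decP t t0.
have h := Expect_normalized_Xplus_sqr decP n1 k.
set f := (fun s => Xplus (dec s).1 (dec s).2 k k / Num.sqrt n%:R).
rewrite EV -/f; apply: le_trans (Chebyshev f _ t0) _.
have -> : 600 ^+ 2 / (t ^+ 2 * Num.sqrt n%:R) = 600 ^+ 2 / Num.sqrt n%:R / t ^+ 2.
  by rewrite invfM mulrA mulrAC.
apply: ler_wpM2r; first by rewrite invr_ge0 sqr_ge0.
exact: le_trans (Variance_le f (4 / (3 * pi))) h.
Qed.
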